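(* For every sufficiently small constant $\varepsilon>0$ there exist constants $C=C(\varepsilon)>0$ and $N_0=N_0(\varepsilon)$ such that the following holds. Let $N\ge N_0$ be a real number, let $f:\mathbb{N}\to\mathbb{C}$ be a multiplicative function satisfying $|f(n)|\le 1$ for all $n\ge 1$, let $q$ be a positive integer with $q\le N^2$, and let $a$ be an integer with $(a,q)=1$. Then $$ \Bigl|\sum_{\substack{n\le N\\ (n,q)=1}} f(n)\,e\!\left(\frac{a\bar n}{q}\right)\Bigr|\le C\left(\sqrt{\frac{\tau(q)}{q}}\,N\log\log(6N)+q^{\frac14+\frac{\varepsilon}{2}}N^{\frac12}(\log(6N))^{\frac12}+\frac{N}{\sqrt{\log\log(6N)}}\right). $$
   Context: Here $n$ runs over positive integers, $e(x)=\exp(2\pi i x)$, $\tau(q)$ is the number of positive divisors of $q$, $(m,q)$ denotes the greatest common divisor, and for $(n,q)=1$, $\bar n$ denotes a multiplicative inverse of $n$ modulo $q$, i.e. $\bar n n\equiv 1 \pmod q$. A function $f$ is multiplicative if $f(1)=1$ and $f(mn)=f(m)f(n)$ whenever $(m,n)=1$. ''For every sufficiently small $\varepsilon>0$'' means: there is $\varepsilon_0>0$ such that the assertion holds for all $0<\varepsilon\le\varepsilon_0$. The constants $C$ and $N_0$ do not depend on $f$, $q$, $a$. *)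

(* Defs.v *)
From mathcomp Require Import all_boot all_order all_algebra.
From mathcomp Require Import all_classical all_reals all_analysis.
From mathcomp Require Import complex.

Set Implicit Arguments.
Unset Strict Implicit.
Unset Printing Implicit Defensive.

Import Order.TTheory GRing.Theory Num.Theory.
Local Open Scope ring_scope.
Local Open Scope complex_scope.

(* e(x) = exp(2 pi i x), through Euler's formula. *)
Definition expi2pi (R : realType) (x : R) : R[i] :=
  cos (2 * pi * x) +i* sin (2 * pi * x).

Definition ndivisors (q : nat) : nat := size (divisors q).

(* The Bezout coefficient u of n in u * n - v * q = gcdn n q. *)
Definition invmodn (q n : nat) : nat := (egcdn n q).1.

Lemma invmodnP (q n : nat) :
  (0 < n)%N -> coprime n q -> (invmodn q n * n = 1 %[mod q])%N.
Proof.
move=> n0 /eqP co; rewrite /invmodn; case: (egcdnP q n0) => u v /= -> _.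
by rewrite co modnMDl.
Qed.

(* Arithmetic functions live on the positive integers: the value f 0 is
   unconstrained. *)
Definition multiplicative_arith (R : realType) (f : nat -> R[i]) : Prop :=
  f 1%N = 1 /\
  forall m n : nat, (0 < m)%N -> (0 < n)%N -> coprime m n ->
    f (m * n)%N = f m * f n.

(* Main.v *)
(** Katai's bilinear method (also Bourgain-Sarnak-Ziegler).  Averaging over
    the primes p of a window [2^i0, 2^i1) with log i0 = o(log i1), the
    Turan-Kubilius inequality replaces S = sum f(n) e(a nbar / q) by L^-1 times
    the bilinear sum of f(p) f(m) e(a pbar mbar / q), where L = sum 1/p is of
    order loglog N.  The primes are cut into short blocks, and on a block the
    2k-th moment over m of the inner sum over p is bounded by the number of
    solutions of
      1/p_1 + ... + 1/p_k = 1/r_1 + ... + 1/r_k  (mod q)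
    in primes of the block.

    If q is small compared with N, take k = 1: the count is controlled by a
    Chebyshev-type bound for primes in progressions modulo q; the logarithm of
    q which it loses is harmless, because the first term of the estimate is
    trivial unless q > (loglog N)^2.  If q is large, take k maximal such that
    the congruence is forced to be an equality of rationals (Karatsuba); then
    every r_j is one of the p_i, and q^(1/2+eps) <= N, without which the second
    term is trivial, makes the bound save a power of the primes used.  No bound
    for Kloosterman sums is needed. *)

Require Import Defs.
From mathcomp Require Import all_boot all_order all_algebra.
From mathcomp Require Import all_classical all_reals all_analysis.
From mathcomp Require Import complex.
From mathcomp Require Import ring lra zify.

Set Implicit Arguments.
Unset Strict Implicit.
Unset Printing Implicit Defensive.

Import Order.TTheory GRing.Theory Num.Theory.

(** * Primes in dyadic intervals and progressions *)

Local Open Scope nat_scope.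

(** The range m <= n / p of the bilinear sum depends on p; this is what forces the blocks.
    Turan-Kubilius, the truncation of the ranges and, for small q, the block sums each cost at most
    a multiple of n L / J as long as J^2 is at most of order L. Division by L leaves n / J, and J of
    order sqrt(loglog N) gives the last term of the estimate.

    For large q there are up to 2^(2h) blocks, with 2^h about log n, and choosing the t_i among the
    values of s costs k^k with k <= 2^(h+2). Every prime has to outweigh these powers of log n, so
    the window starts at an i0 linear in h. It ends at i1 = 2^(h-b), a small multiple of log n, to
    ensure k >= 2E: then the gain from q^(1/2+1/E) <= n + 1 exceeds the losses from rounding k and
    from passing from n to n / p. The exponent eps enters only through the integer E, with 1/E <=
    eps. *)

Lemma sum_residue_le (q a m l : nat) : 0 < q ->
  \sum_(m <= p < m + l | p == a %[mod q]) 1 <= l %/ q + 1.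
Proof.
move=> q0; rewrite sum1_count -size_filter.
set s := [seq p <- _ | _].
have us : uniq s by rewrite filter_uniq // iota_uniq.
have ms p : p \in s -> [/\ m <= p, p < m + l & p = a %[mod q]].
  by rewrite mem_filter mem_index_iota => /and3P[/eqP ? -> ->].
have inj : {in s &, injective (fun p => (p - m) %/ q)}.
  move=> x y /ms[mx xl xa] /ms[my yl ya] e.
  have xy : x = y %[mod q] by rewrite xa.
  have : (x - m) %% q = (y - m) %% q.
    by apply/eqP; rewrite -(eqn_modDr m) !subnK //; apply/eqP.
  move=> e2; have := divn_eq (x - m) q; rewrite e e2 -divn_eq; lia.
rewrite -(size_map (fun p => (p - m) %/ q)).
rewrite -[X in _ <= X](size_iota 0); apply: uniq_leq_size.
  by rewrite map_inj_in_uniq.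
move=> _ /mapP[x /ms[mx xl _] ->]; rewrite mem_iota /= add0n addn1 ltnS.
by apply: leq_div2r; lia.
Qed.

Lemma logn_fact_le (p n : nat) : prime p -> p.-1 * logn p n`! <= n.
Proof.
move=> pp; rewrite logn_fact //.
have p1 := prime_gt1 pp.
(* The quotient n / p^K is carried along because the left side is then non-increasing in K. *)
suff H K : p.-1 * (\sum_(1 <= k < K.+1) n %/ p ^ k) + n %/ p ^ K <= n.
  by apply: leq_trans (H n); rewrite leq_addr.
elim: K => [|K IH]; first by rewrite big_geq // muln0 expn0 divn1.
rewrite big_nat_recr //= mulnDr; apply: leq_trans IH.
rewrite -addnA leq_add2l expnSr divnMA.
have := leq_trunc_div (n %/ p ^ K) p; have : 0 < p by lia.
set x := _ %/ p; set y := n %/ _; nia.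
Qed.

(** With u an inverse of q modulo B, multiplication by u^n turns the product into one of n
    consecutive integers, a binomial coefficient times n!. Since u^n is prime to B, it can be
    cancelled. *)
Lemma dvdn_prod_ap (q a n B : nat) : coprime q B -> 0 < B -> B %| n`! ->
  B %| \prod_(j < n) (a + q * j.+1).
Proof.
move=> co B0 Bn; have q0 : 0 < q \/ q = 0 by lia.
case: q0 => [q0|q0]; last first.
  by move: co; rewrite q0 /coprime gcd0n => /eqP ->; rewrite dvd1n.
case: (egcdnP B q0) => u v uv _; move: co => /eqP co.
rewrite co in uv.
have cuB : coprime B (u ^ n).
  apply: coprimeXr; rewrite coprime_sym.
  have : coprime (u * q) B by rewrite uv /coprime gcdnC gcdnMDl gcdn1.
  by rewrite coprimeMl => /andP[].
rewrite -(Gauss_dvdr _ cuB).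
have -> : u ^ n = \prod_(j < n) u by rewrite prod_nat_const card_ord.
rewrite -big_split /=.
have H : \prod_(j < n) (u * (a + q * j.+1)) = \prod_(j < n) (u * a + j.+1) %[mod B].
  elim/big_ind2: _ => // [x1 x2 y1 y2 e1 e2|j _].
    by rewrite -modnMm e1 e2 modnMm.
  by rewrite mulnDr mulnA uv mulnDl mul1n addnCA mulnAC modnMDl.
rewrite /dvdn H -/(dvdn _ _).
have -> : \prod_(j < n) (u * a + j.+1) = (u * a + n) ^_ n.
  elim: n {H cuB Bn} => [|k IH]; first by rewrite big_ord0 ffactn0.
  by rewrite big_ord_recr /= IH addnS ffactSS mulnC.
by rewrite -bin_ffact dvdn_mull.
Qed.

Lemma dvdn_prod_primes (s : seq nat) (X : nat) : uniq s ->
  (forall p, p \in s -> prime p /\ p %| X) -> \prod_(p <- s) p %| X.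
Proof.
elim: s => [|p s IH] /=; first by rewrite big_nil dvd1n.
move=> /andP[ps us] H; rewrite big_cons Gauss_dvd.
  apply/andP; split; first by case: (H p); rewrite ?mem_head.
  by apply: IH => // r rs; apply: H; rewrite inE rs orbT.
rewrite big_seq; elim/big_ind: _ => [|x y cx cy|r rs].
- by rewrite coprimen1.
- by rewrite coprimeMr cx.
have [pp _] := H p (mem_head _ _).
have [pr _] : prime r /\ r %| X by apply: H; rewrite inE rs orbT.
by rewrite prime_coprime // dvdn_prime2 //; apply: contra ps => /eqP ->.
Qed.

(* Chebyshev's argument in the progression a modulo q: the product of the
   terms a + q, ..., a + n q is divisible by the part of n! prime to q, and by
   the listed primes because they exceed n. *)
Lemma prod_primes_ap_le (q a n : nat) (s : seq nat) : 0 < q -> a < q -> uniq s ->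
  (forall p, p \in s -> [/\ prime p, coprime p q, n < p, q <= p &
     p %/ q <= n /\ p %% q = a]) ->
  \prod_(p <- s) p <= q ^ (2 * n) * n.+1.
Proof.
move=> q0 aq us H.
pose A := n`!`_(\pi(q)); pose B := n`!`_(\pi(q)^').
have AB : A * B = n`! by rewrite partnC // fact_gt0.
have B0 : 0 < B by apply: part_gt0.
have A0 : 0 < A by apply: part_gt0.
have Bn : B %| n`! by rewrite dvdn_part.
(* A prime dividing q occurs in n! at most n times, hence no more often than in q^n. *)
have Aq : A <= q ^ n.
  apply: dvdn_leq; first by rewrite expn_gt0 q0.
  apply/dvdn_partP => // p.
  rewrite mem_primes => /and3P[pp _ pA].
  have pq : p \in \pi(q).
    have /pnatP := part_pnat (\pi(q)) n`!; apply => //.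
  rewrite p_part pfactor_dvdn ?expn_gt0 ?q0 // lognX.
  have lA : logn p A <= logn p n`! by apply: dvdn_leq_log; rewrite ?fact_gt0 ?dvdn_part.
  have lq : 0 < logn p q by move: pq; rewrite inE /= logn_gt0.
  have := logn_fact_le n pp; have := prime_gt1 pp; nia.
have D1 : \prod_(p <- s) p %| \prod_(j < n) (a + q * j.+1).
  apply: dvdn_prod_primes => // p /H [pp cp np qp [pn pa]]; split => //.
  have t0 : 0 < p %/ q by rewrite divn_gt0.
  have tn : (p %/ q).-1 < n by lia.
  rewrite (bigD1 (Ordinal tn)) //= prednK // -{1}pa [q * _]mulnC addnC -divn_eq.
  by rewrite dvdn_mulr.
have D2 : B %| \prod_(j < n) (a + q * j.+1).
  apply: dvdn_prod_ap => //; rewrite coprime_sym /B.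
  have := @coprime_partC \pi(q) q n`!; rewrite part_pnat_id // ?pnat_pi //.
  by rewrite coprime_sym.
have D3 : coprime (\prod_(p <- s) p) B.
  rewrite big_seq; elim/big_ind: _ => [|x y cx cy|p /H[pp _ np _ _]].
  - by rewrite coprime1n.
  - by rewrite coprimeMl cx.
  rewrite prime_coprime //; apply/negP => pB.
  have := dvdn_trans pB Bn; rewrite fact_prod Euclid_dvd_prod // big_has.
  move=> /hasP[x]; rewrite mem_index_iota => /andP[x1 xn] /= /dvdn_leq; lia.
have D : \prod_(p <- s) p * B <= \prod_(j < n) (a + q * j.+1).
  apply: dvdn_leq; last by rewrite Gauss_dvd // D1.
  by apply: prodn_gt0 => j; nia.
have U : \prod_(j < n) (a + q * j.+1) <= q ^ n * (n.+1)`!.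
  have -> : (n.+1)`! = \prod_(j < n) j.+2.
    by rewrite fact_prod big_add1 /= big_nat_recl // mul1n big_mkord.
  have -> : q ^ n = \prod_(j < n) q by rewrite prod_nat_const card_ord.
  rewrite -big_split /=; apply: leq_prod => j _; nia.
(* Restoring the factor A of n! costs a second q^n; the two factors q^n are the source of log q in
   the counting bound. *)
have F : \prod_(p <- s) p * n`! <= q ^ (2 * n) * n.+1 * n`!.
  rewrite -AB mulnCA mulnC -mulnA.
  move: D U; rewrite factS.
  have -> : q ^ (2 * n) = q ^ n * q ^ n by rewrite mul2n -addnn expnD.
  rewrite -[_ * (A * B)]mulnA -!AB.
  set X := \prod_(p <- s) p; set Y := \prod_(j < n) _; set Q := q ^ n.
  move=> D U; have : A * (X * B) <= Q * (Q * (n.+1 * (A * B))).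
    by apply: leq_mul => //; apply: leq_trans U.
  nia.
by move: F; rewrite leq_pmul2r // fact_gt0.
Qed.

Lemma count_primes_ap (q a i : nat) : 4 <= q -> 0 < i ->
  q * i * (\sum_(2 ^ i <= p < 2 ^ i.+1 |
    [&& prime p, coprime p q & p == a %[mod q]]) 1)
  <= 4 * 2 ^ i * up_log 2 q + 4 * q * i.
Proof.
move=> q4 i0; have q0 : 0 < q by lia.
have [qi|iq] := leqP q (2 ^ i); last first.
  have c1 : \sum_(2 ^ i <= p < 2 ^ i.+1 |
      [&& prime p, coprime p q & p == a %[mod q]]) 1 <= 1.
    have := sum_residue_le a (2 ^ i) (2 ^ i) q0; rewrite divn_small // add0n.
    rewrite expnS mul2n -addnn; apply: leq_trans.
    rewrite [X in _ <= X]big_mkcond [X in X <= _]big_mkcond /=. apply: leq_sum => p _.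
    by case: (p == a %[mod q]); rewrite ?andbF //; case: ifP.
  move: c1; set c := \sum_(_ <= _ < _ | _) _; nia.
set lam := up_log 2 q.
have lami : lam <= i by apply: up_log_min.
have qlam : q <= 2 ^ lam by apply: up_logP.
(* All quotients p / q on the interval are at most n, while q >= 4 keeps n below 2^i, hence below
   every prime of the interval. *)
set n := (2 ^ i.+1 %/ q).+1.
have i2 : 2 <= i by case: i i0 qi {lami n} => [|[|i]] //; lia.
have [k ek] : exists k, 2 ^ i = 2 * k by exists (2 ^ i.-1); rewrite -expnS prednK.
have k2 : 2 <= k.
  have : 2 ^ 2 <= 2 ^ i by rewrite leq_exp2l.
  by rewrite ek; lia.
have n2 : n < 2 ^ i.
  have : 2 ^ i.+1 %/ q <= 2 ^ i.+1 %/ 4 by apply: leq_div2l.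
  have e4 : 2 ^ i.+1 = 4 * k by rewrite expnS ek; lia.
  rewrite e4 mulKn // => h; rewrite /n e4 ek; lia.
pose s := [seq p <- index_iota (2 ^ i) (2 ^ i.+1) |
    [&& prime p, coprime p q & p == a %[mod q]]].
have -> : \sum_(2 ^ i <= p < 2 ^ i.+1 |
      [&& prime p, coprime p q & p == a %[mod q]]) 1 = size s.
  by rewrite sum1_count size_filter.
have sP p : p \in s -> [/\ prime p, coprime p q, p == a %[mod q], 2 ^ i <= p & p < 2 ^ i.+1].
  by rewrite mem_filter mem_index_iota => /andP[/and3P[-> -> ->] /andP[-> ->]].
have := @prod_primes_ap_le q (a %% q) n s q0 (ltn_pmod _ q0).
rewrite filter_uniq ?iota_uniq // => /(_ isT) H.
have {}H : \prod_(p <- s) p <= q ^ (2 * n) * n.+1.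
  apply: H => p /sP [pp cp /eqP pa pi pi1]; split => //.
  - exact: leq_trans n2 pi.
  - exact: leq_trans qi pi.
  split => //; rewrite /n; apply: leqW; apply: leq_div2r; lia.
have lo : 2 ^ (i * size s) <= \prod_(p <- s) p.
  have : forall p, p \in s -> 2 ^ i <= p by move=> p /sP[].
  elim: (s) => [|p t IH] pt; first by rewrite big_nil muln0.
  rewrite big_cons /= mulnS expnD leq_mul ?pt ?mem_head //.
  by apply: IH => r rt; rewrite pt // inE rt orbT.
have up : q ^ (2 * n) * n.+1 <= 2 ^ (lam * (2 * n) + i).
  rewrite expnD; apply: leq_mul => //.
  by rewrite [2 ^ _]expnM leq_exp2r // /n muln_gt0.
have := leq_trans lo (leq_trans H up); rewrite leq_exp2l // => le.
have nq : q * n <= 2 * 2 ^ i + q.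
  rewrite /n mulnS addnC leq_add2r mulnC -expnS; exact: leq_trunc_div.
move: le; set c := size s => le.
have : q * (i * c) <= q * (lam * (2 * n) + i) by rewrite leq_mul2l le orbT.
have : 2 * lam * (q * n) <= 2 * lam * (2 * 2 ^ i + q) by rewrite leq_mul2l nq orbT.
have : q * lam <= q * i by rewrite leq_mul2l lami orbT.
set x := 2 ^ i; rewrite !mulnDr; nia.
Qed.

(* Apply the bound for progressions modulo 4. *)
Lemma count_primes_dyadic (i : nat) : 0 < i ->
  i * (\sum_(2 ^ i <= p < 2 ^ i.+1 | prime p) 1) <= 12 * 2 ^ i.
Proof.
move=> i0.
have h a := @count_primes_ap 4 a i isT i0.
(* Odd primes are 1 or 3 modulo 4; the prime 2 is missed by both classes and occurs only for i =
   1. *)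
have le : \sum_(2 ^ i <= p < 2 ^ i.+1 | prime p) 1 <=
   \sum_(2 ^ i <= p < 2 ^ i.+1 | [&& prime p, coprime p 4 & p == 1 %[mod 4]]) 1 +
   \sum_(2 ^ i <= p < 2 ^ i.+1 | [&& prime p, coprime p 4 & p == 3 %[mod 4]]) 1
   + (i == 1).
  have e1 : ((i == 1) : nat) = \sum_(2 ^ i <= p < 2 ^ i.+1) ((i == 1) && (p == 2)).
    case: (altP (i =P 1)) => [->|_] /=; last by rewrite big1.
    by rewrite big_nat_recl // big_nat1 /=.
  rewrite e1 big_mkcond /= [X in _ <= X + _ + _]big_mkcond [X in _ <= _ + X + _]big_mkcond /=.
  rewrite -!big_split /=; rewrite !big_nat; apply: leq_sum => p /andP[ip pi].
  case pp : (prime p) => //=.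
  have [p2|] := eqVneq p 2.
    have -> : i == 1.
      have i1 : i < 2 by rewrite -(ltn_exp2l _ _ (isT : 1 < 2)); apply: leq_ltn_trans ip _; rewrite p2.
      by apply/eqP; lia.
    by rewrite addn1.
  move=> p2; have op : odd p by case: (even_prime pp) p2 => // ->.
  have -> : coprime p 4 by rewrite -[4]/(2 ^ 2) coprimeXr // coprimen2.
  have : p %% 4 = 1 \/ p %% 4 = 3 by lia.
  by rewrite /=; move=> [->|->].
have := h 1; have := h 3; rewrite [up_log 2 4]/=.
have ii : i <= 2 ^ i by apply: ltnW; apply: ltn_expl.
have -> : up_log 2 4 = 2 by apply/eqP; rewrite -[4]/(2 ^ 2) up_expnK.
move: le; set c := \sum_(_ <= _ < _ | _) _; set c1 := \sum_(_ <= _ < _ | _) _.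
set c3 := \sum_(_ <= _ < _ | _) _.
case: (altP (i =P 1)) => [->|i1] /=; first by lia.
have i3 : 4 * i <= 2 * 2 ^ i.
  case: i i0 i1 {h c c1 c3 ii} => [|[|i]] // _ _; elim: i => // i; rewrite !expnS; lia.
nia.
Qed.

Lemma fact_prod_primes (n : nat) :
  n`! = \prod_(0 <= p < n.+1 | prime p) p ^ logn p n`!.
Proof.
have n1 : n <= n`!.
  by case: n => // n; rewrite factS leq_pmulr // fact_gt0.
have := widen_partn predT (leqnn n`!).
rewrite partnT ?fact_gt0 // => e; rewrite {1}e {e}.
rewrite (@big_cat_nat _ _ _ n.+1) //= [X in _ * X]big1_seq ?muln1.
  rewrite [RHS]big_mkcond; apply: eq_bigr => p _.
  by case: ifP => // pp; rewrite lognE pp.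
move=> p /=; rewrite mem_index_iota => /andP[np _].
rewrite lognE; case: ifP => // /and3P[pp _].
rewrite [X in p %| X]fact_prod Euclid_dvd_prod // big_has.
by move=> /hasP[x]; rewrite mem_index_iota => /andP[x1 xn] /= /dvdn_leq; lia.
Qed.

(** n^n is at most (n+1)...(2n) = C(2n, n) n!, and C(2n, n) <= 4^n. *)
Lemma expnn_le_fact (n : nat) : n ^ n <= 4 ^ n * n`!.
Proof.
have b4 : 'C(n + n, n) <= 4 ^ n.
  have -> : 4 ^ n = 2 ^ (n + n) by rewrite -(expnM 2 2 n) mul2n addnn.
  rewrite (_ : 2 ^ (n + n) = (1 + 1) ^ (n + n)) // Pascal.
  have nn : n < (n + n).+1 by lia.
  by rewrite (bigD1 (Ordinal nn)) //= !exp1n !muln1 leq_addr.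
apply: (@leq_trans ((n + n) ^_ n)); last first.
  by rewrite -bin_ffact leq_mul2r b4 orbT.
have H k : n ^ k <= (n + k) ^_ k.
  by elim: k => [|k IH] //; rewrite addnS ffactSS expnS leq_mul // leqW // leq_addr.
exact: H.
Qed.

Lemma dyadic_split (V : Type) (idx : V) (op : Monoid.law idx) (I : nat)
    (P : pred nat) (F : nat -> V) : ~~ P 0 ->
  \big[op/idx]_(0 <= p < 2 ^ I | P p) F p =
  \big[op/idx]_(0 <= i < I) \big[op/idx]_(2 ^ i <= p < 2 ^ i.+1 | P p) F p.
Proof.
move=> P0; elim: I => [|I IH].
  by rewrite [RHS]big_geq // expn0 big_mkcond big_nat1 (negbTE P0).
by rewrite big_nat_recr //= -IH -big_cat_nat // leq_exp2l.
Qed.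

Local Open Scope ring_scope.

Section PrimeSums.
Variable R : realFieldType.

Definition dyadic_prime_sum (i : nat) : R :=
  \sum_(2 ^ i <= p < 2 ^ i.+1 | prime p) p%:R^-1.

Lemma dyadic_prime_sum_ge0 i : 0 <= dyadic_prime_sum i.
Proof. by apply: sumr_ge0 => p _; rewrite invr_ge0. Qed.

Lemma dyadic_prime_sum_le i : (0 < i)%N -> i%:R * dyadic_prime_sum i <= 12.
Proof.
move=> i0; have := count_primes_dyadic i0.
rewrite -(ler_nat R) !natrM natr_sum => h.
have x0 : (0 : R) < (2 ^ i)%:R by rewrite ltr0n expn_gt0.
rewrite -(ler_pM2r x0); apply: le_trans h.
rewrite -mulrA ler_wpM2l // /dyadic_prime_sum mulr_suml [leLHS]big_nat_cond.
rewrite [leRHS]big_nat_cond; apply: ler_sum => p /andP[/andP[ip _] pp].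
rewrite ler_pdivrMl ?mulr1 ?ler_nat // ltr0n prime_gt0 //.
Qed.

(* Compares n^n <= 4^n n! with the factorization of n! for n = 2^(I-1). *)
Lemma weighted_prime_sum_ge (I : nat) : (0 < I)%N ->
  I%:R - 3 <= 2 * \sum_(0 <= i < I) i.+1%:R * dyadic_prime_sum i.
Proof.
case: I => // K _; pose n := (2 ^ K)%N.
have n0 : (0 < n)%N by rewrite expn_gt0.
have le1 : (2 ^ (K * n) <=
   2 ^ (2 * n + \sum_(0 <= p < n.+1 | prime p) (trunc_log 2 p).+1 * logn p n`!))%N.
  rewrite [X in (X <= _)%N]expnM -/n; apply: leq_trans (expnn_le_fact n) _.
  rewrite expnD [(2 ^ (2 * n))%N]expnM leq_mul2l; apply/orP; right.
  rewrite {1}fact_prod_primes expn_sum; apply: leq_prod => p pp.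
  rewrite expnM; case: (posnP (logn p n`!)) => [->//|l0].
  by rewrite leq_exp2r // ltnW // trunc_log_ltn.
have {}le1 : (K * n <= 2 * n + \sum_(0 <= p < n.+1 | prime p) (trunc_log 2 p).+1 * logn p n`!)%N.
  by move: le1; rewrite leq_exp2l.
have le2 : n%:R * K%:R <= n%:R * (2 + \sum_(0 <= p < n.+1 | prime p) 2 * ((trunc_log 2 p).+1%:R / p%:R)) :> R.
  move: le1; rewrite -(ler_nat R) natrD !natrM natr_sum mulrC => /le_trans; apply.
  rewrite mulrDr (mulrC 2) lerD2l mulr_sumr; apply: ler_sum => p pp.
  have p1 := prime_gt1 pp.
  have lp := logn_fact_le n pp.
  have p0 : (0 : R) < p%:R by rewrite ltr0n prime_gt0.
  (* From (p - 1) v_p(n!) <= n and p <= 2 (p - 1); this is the factor 2 of the conclusion. *)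
  have : (p * logn p n`! <= 2 * n)%N by nia.
  rewrite -(ler_nat R) !natrM => lq.
  rewrite !mulrA ler_pdivlMr //.
  have : (0 : R) <= (trunc_log 2 p).+1%:R by [].
  nra.
rewrite ler_pM2l ?ltr0n // in le2.
rewrite -mulr_sumr in le2.
have le3 : \sum_(0 <= p < n.+1 | prime p) ((trunc_log 2 p).+1%:R / p%:R) <=
    \sum_(0 <= i < K.+1) i.+1%:R * dyadic_prime_sum i :> R.
  apply: (@le_trans _ _ (\sum_(0 <= p < 2 ^ K.+1 | prime p) ((trunc_log 2 p).+1%:R / p%:R))).
    rewrite [leRHS](@big_cat_nat _ _ _ n.+1) //=; last first.
      by rewrite expnS mul2n -addnn -/n -addn1 leq_add2l.
    by rewrite lerDl; apply: sumr_ge0 => p _; rewrite divr_ge0.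
  rewrite dyadic_split //; apply: ler_sum => i _.
  rewrite /dyadic_prime_sum mulr_sumr [leLHS]big_nat_cond [leRHS]big_nat_cond.
  apply: ler_sum => p /andP[/andP[ip pi] pp].
  by rewrite (@trunc_log_eq 2 i) // ip pi.
have : K.+1%:R = K%:R + 1 :> R by rewrite -addn1 natrD.
lra.
Qed.

(** The weighted sum over i < 128 I is at least (128 I - 3) / 2. Its terms with i < I contribute at
    most 24 I, and the others have weights at most 128 I, so at least (40 I - 3/2) / (128 I) >= 1/4
    remains. *)
Lemma prime_sum_group (I : nat) : (0 < I)%N ->
  1 / 4 <= \sum_(I <= i < 128 * I) dyadic_prime_sum i.
Proof.
move=> I0; have I128 : (I <= 128 * I)%N by lia.
have I0' : (0 < 128 * I)%N by lia.
have := weighted_prime_sum_ge I0'.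
rewrite (@big_cat_nat _ _ _ I) //=.
have up : \sum_(0 <= i < I) i.+1%:R * dyadic_prime_sum i <= 24 * I%:R.
  have -> : 24 * I%:R = \sum_(0 <= i < I) 24 :> R.
    by rewrite big_const_nat iter_addr_0 subn0 mulr_natr.
  apply: ler_sum => i _; case: i => [|i].
    have -> : dyadic_prime_sum 0 = 0.
      by rewrite /dyadic_prime_sum big_mkcond big_nat1.
    by rewrite mulr0.
  have := @dyadic_prime_sum_le i.+1 isT; have := dyadic_prime_sum_ge0 i.+1.
  rewrite -[i.+2]addn1 natrD; have : 1 <= i.+1%:R :> R by rewrite ler1n.
  nra.
have up2 : \sum_(I <= i < 128 * I) i.+1%:R * dyadic_prime_sum i <=
   128 * I%:R * \sum_(I <= i < 128 * I) dyadic_prime_sum i.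
  rewrite mulr_sumr !big_nat; apply: ler_sum => i /andP[_ iI].
  by rewrite ler_wpM2r ?dyadic_prime_sum_ge0 // -natrM ler_nat.
move: up up2; rewrite natrM.
set x := \sum_(_ <= _ < _) _; set y := \sum_(_ <= _ < _) _; set z := \sum_(_ <= _ < _) _.
have : 1 <= I%:R :> R by rewrite ler1n.
nra.
Qed.

Lemma prime_sum_groups (I t : nat) : (0 < I)%N ->
  t%:R / 4 <= \sum_(I <= i < 128 ^ t * I) dyadic_prime_sum i.
Proof.
move=> I0; elim: t => [|t IH]; first by rewrite mul0r sumr_ge0 // => i _; apply: dyadic_prime_sum_ge0.
rewrite (@big_cat_nat _ _ _ (128 ^ t * I)) //=.
- have := @prime_sum_group (128 ^ t * I).
  rewrite mulnA -expnS muln_gt0 expn_gt0 I0 => /(_ isT).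
  rewrite -[t.+1]addn1 natrD; lra.
- by rewrite leq_pmull // expn_gt0.
- by rewrite leq_mul2r leq_exp2l // leqnSn orbT.
Qed.

End PrimeSums.

(** * The Turan-Kubilius inequality *)

Lemma natdiv_le (R : realFieldType) (n d : nat) : (n %/ d)%N%:R <= n%:R / d%:R :> R.
Proof.
case: d => [|d]; first by rewrite divn0 invr0 mulr0.
by rewrite ler_pdivlMr ?ltr0n // -natrM ler_nat leq_trunc_div.
Qed.

Lemma natdiv_ge (R : realFieldType) (n d : nat) : (0 < d)%N -> n%:R / d%:R - 1 <= (n %/ d)%N%:R :> R.
Proof.
move=> d0; rewrite lerBlDr ler_pdivrMr ?ltr0n // natr1 -natrM ler_nat.
by have := ltn_ceil n d0; lia.
Qed.

Section TuranKubilius.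
Variable R : realFieldType.
Variables (X n : nat) (Q : pred nat).
Hypothesis Qprime : forall p, Q p -> prime p.
Hypothesis leXn : (X <= n)%N.

Definition recip_sum : R := \sum_(0 <= p < X | Q p) p%:R^-1.
Definition omega_count (m : nat) : R := \sum_(0 <= p < X | Q p) (p %| m)%N%:R.

Lemma recip_sum_ge0 : 0 <= recip_sum.
Proof. by apply: sumr_ge0 => p _; rewrite invr_ge0. Qed.

Lemma natr_count_dvd (d : nat) :
  \sum_(1 <= m < n.+1) (d %| m)%N%:R = (n %/ d)%N%:R :> R.
Proof. by rewrite divn_count_dvd natr_sum. Qed.

(** The second moment needs only the upper bound floor(n / pr) <= n / pr, which has no error term.
    Rounding matters only in the lower bound for the first moment, where it loses at most X <= n in
    total; so primes up to n are allowed, not just up to sqrt n. *)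
Lemma turan_kubilius :
  \sum_(1 <= m < n.+1) (omega_count m - recip_sum) ^+ 2 <= 3 * n%:R * recip_sum.
Proof.
have S1 : n%:R * recip_sum - n%:R <= \sum_(1 <= m < n.+1) omega_count m.
  rewrite exchange_big /=; under eq_bigr do rewrite natr_count_dvd.
  have le : n%:R * recip_sum - X%:R <= \sum_(0 <= p < X | Q p) (n %/ p)%N%:R.
    apply: (@le_trans _ _ (\sum_(0 <= p < X | Q p) (n%:R / p%:R - 1))).
      rewrite sumrB /recip_sum -mulr_sumr lerD2l lerN2.
      rewrite big_mkcond; apply: (@le_trans _ _ (\sum_(0 <= p < X) 1)).
        by apply: ler_sum => p _; case: ifP.
      by rewrite big_const_nat iter_addr_0 subn0.
    by apply: ler_sum => p /Qprime pp; apply: natdiv_ge; apply: prime_gt0.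
  apply: le_trans le; rewrite lerD2l lerN2 ler_nat //.
have S2 : \sum_(1 <= m < n.+1) omega_count m ^+ 2 <= n%:R * recip_sum ^+ 2 + n%:R * recip_sum.
  have -> : \sum_(1 <= m < n.+1) omega_count m ^+ 2 =
    \sum_(0 <= p < X | Q p) \sum_(0 <= r < X | Q r) \sum_(1 <= m < n.+1) ((p %| m) && (r %| m))%N%:R.
    under [RHS]eq_bigr do rewrite exchange_big /=.
    rewrite [RHS]exchange_big /=.
    apply: eq_bigr => m _; rewrite expr2 /omega_count mulr_suml.
    apply: eq_bigr => p _; rewrite mulr_sumr; apply: eq_bigr => r _.
    by rewrite -natrM mulnb.
  have -> : n%:R * recip_sum ^+ 2 + n%:R * recip_sum =
    \sum_(0 <= p < X | Q p) (\sum_(0 <= r < X | Q r) (n%:R / (p * r)%N%:R) + n%:R / p%:R) :> R.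
    rewrite big_split /= -mulr_sumr; congr (_ + _).
    rewrite expr2 {1}/recip_sum mulr_suml mulr_sumr; apply: eq_bigr => p _.
    rewrite /recip_sum !mulr_sumr; apply: eq_bigr => r _.
    by rewrite natrM invfM.
  rewrite [leLHS]big_nat_cond [leRHS]big_nat_cond.
  apply: ler_sum => p /andP[/andP[_ pX] Qp].
  have pp := Qprime Qp.
  have -> : n%:R / p%:R = \sum_(0 <= r < X | Q r) (r == p)%:R * (n%:R / p%:R) :> R.
    rewrite big_mkcond (bigD1_seq p) ?iota_uniq ?mem_index_iota //= Qp eqxx mul1r.
    by rewrite big1 ?addr0 // => r /negbTE ->; rewrite mul0r; case: ifP.
  rewrite -big_split; apply: ler_sum => r /Qprime pr /=.
  have [->|rp] := eqVneq r p.
    under eq_bigr do rewrite andbb.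
    by rewrite natr_count_dvd mul1r; apply: le_trans (natdiv_le R n p) _; rewrite lerDr divr_ge0.
  rewrite mul0r addr0.
  have e m : (p %| m)%N && (r %| m)%N = (p * r %| m)%N.
    by rewrite Gauss_dvd // prime_coprime // dvdn_prime2 // eq_sym.
  under eq_bigr do rewrite e.
  by rewrite natr_count_dvd natdiv_le.
have -> : \sum_(1 <= m < n.+1) (omega_count m - recip_sum) ^+ 2 =
    \sum_(1 <= m < n.+1) omega_count m ^+ 2 - 2 * recip_sum * \sum_(1 <= m < n.+1) omega_count m
    + n%:R * recip_sum ^+ 2.
  have -> : n%:R * recip_sum ^+ 2 = \sum_(1 <= m < n.+1) recip_sum ^+ 2.
    by rewrite big_const_nat iter_addr_0 subSS subn0 mulr_natl.
  rewrite mulr_sumr -sumrB -big_split; apply: eq_bigr => m _ /=; ring.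
have := recip_sum_ge0; nra.
Qed.

(** The inequality of the means with a free weight J replaces Cauchy-Schwarz and avoids the square
    root of L; the two terms balance when J is about sqrt L. *)
Lemma sum_abs_omega_le (J : R) : 0 < J -> 0 < recip_sum ->
  \sum_(1 <= m < n.+1) `|omega_count m - recip_sum|
    <= n%:R * (2 * J + recip_sum / J).
Proof.
move=> J0 L0; set L := recip_sum.
apply: (@le_trans _ _ (\sum_(1 <= m < n.+1) ((omega_count m - L) ^+ 2 * (J / L) + L / J) / 2)).
  apply: ler_sum => m _; rewrite -real_normK ?num_real //.
  set x := `|_|; have : 0 <= (x * (J / L) - 1) ^+ 2 * (L / J).
    by rewrite mulr_ge0 ?sqr_ge0 // divr_ge0 // ltW.
  have -> : (x * (J / L) - 1) ^+ 2 * (L / J) = x ^+ 2 * (J / L) - 2 * x + L / J.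
    by field; rewrite !gt_eqF.
  lra.
rewrite -mulr_suml big_split /= -mulr_suml.
have -> : \sum_(1 <= m < n.+1) L / J = n%:R * (L / J).
  by rewrite big_const_nat iter_addr_0 subSS subn0 mulr_natl.
have := turan_kubilius; rewrite -/L; set S := \sum_(_ <= _ < _) _ => h.
have : S * (J / L) <= 3 * n%:R * J.
  rewrite mulrA ler_pdivrMr //; nra.
have : 0 <= n%:R * J by rewrite mulr_ge0 // ltW.
have : 0 <= n%:R * (L / J) by rewrite mulr_ge0 // divr_ge0 // ltW.
lra.
Qed.

End TuranKubilius.

(** * Moments of exponential sums *)

Local Open Scope complex_scope.

Section ComplexAbs.
Variable R : rcfType.
Implicit Types x y z : R[i].

(** The norm of [R[i]] takes its values in [R[i]]; its real part brings the modulus into the ordered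
    field where the estimates take place. *)
Definition cabs (z : R[i]) : R := complex.Re `|z|.

Lemma cabsE z : `|z| = (cabs z)%:C.
Proof. by rewrite /cabs normc_def. Qed.

Lemma cabs_ge0 z : 0 <= cabs z.
Proof. by rewrite -lecR -cabsE normr_ge0. Qed.

Lemma cabsM x y : cabs (x * y) = cabs x * cabs y.
Proof. by apply: (@complexI R); rewrite rmorphM -!cabsE normrM. Qed.

Lemma cabsX x n : cabs (x ^+ n) = cabs x ^+ n.
Proof. by apply: (@complexI R); rewrite rmorphXn -!cabsE normrX. Qed.

Lemma cabs0 : cabs 0 = 0.
Proof. by apply: (@complexI R); rewrite -cabsE normr0. Qed.

Lemma cabs1 : cabs 1 = 1.
Proof. by apply: (@complexI R); rewrite -cabsE normr1. Qed.

Lemma cabsD x y : cabs (x + y) <= cabs x + cabs y.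
Proof. by rewrite -lecR rmorphD /= -!cabsE ler_normD. Qed.

Lemma cabsN x : cabs (- x) = cabs x.
Proof. by apply: (@complexI R); rewrite -!cabsE normrN. Qed.

Lemma cabs_real (a : R) : cabs a%:C = `|a|.
Proof. by apply: (@complexI R); rewrite -cabsE normc_def /= expr0n /= addr0 sqrtr_sqr. Qed.

Lemma cabs_sum (I : Type) (r : seq I) (P : pred I) (F : I -> R[i]) :
  cabs (\sum_(i <- r | P i) F i) <= \sum_(i <- r | P i) cabs (F i).
Proof.
elim/big_ind2: _ => [|x1 x2 y1 y2 h1 h2|//]; first by rewrite cabs0.
by apply: le_trans (cabsD _ _) _; apply: lerD.
Qed.

Lemma cabs_prod (I : Type) (r : seq I) (P : pred I) (F : I -> R[i]) :
  cabs (\prod_(i <- r | P i) F i) = \prod_(i <- r | P i) cabs (F i).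
Proof. by elim/big_ind2: _ => [|x1 x2 y1 y2 <- <-|//]; rewrite ?cabs1 ?cabsM. Qed.

Lemma cabs_sqr z : (cabs z ^+ 2)%:C = z * z^*.
Proof. by rewrite rmorphXn /= -cabsE sqr_normc. Qed.

Lemma cabs_unity_root (q : nat) (w : R[i]) : (0 < q)%N -> w ^+ q = 1 -> cabs w = 1.
Proof.
move=> q0 w1; have : cabs w ^+ q = 1 by rewrite -cabsX w1 cabs1.
by move/eqP; rewrite pexpr_eq1 ?cabs_ge0 // => /eqP.
Qed.

Section Moments.
Variables (q : nat) (zeta : R[i]).
Hypothesis zeta_prim : q.-primitive_root zeta.

Let q_gt0 : (0 < q)%N. Proof. exact: prim_order_gt0 zeta_prim. Qed.

Lemma cabs_zeta k : cabs (zeta ^+ k) = 1.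
Proof. by rewrite cabsX (cabs_unity_root q_gt0 (prim_expr_order zeta_prim)) expr1n. Qed.

Lemma sum_unity_root (w : R[i]) : w ^+ q = 1 -> w != 1 -> \sum_(0 <= x < q) w ^+ x = 0.
Proof.
move=> wq w1; apply: (mulfI (x := w - 1)); first by rewrite subr_eq0.
by rewrite mulr0 big_mkord -subrX1 wq subrr.
Qed.

Lemma zeta_orthogonality (u v : nat) :
  \sum_(0 <= x < q) (zeta ^+ (u * x) * (zeta ^+ (v * x))^*)
    = if u == v %[mod q] then q%:R else 0.
Proof.
set w := zeta ^+ u * (zeta ^+ v)^*.
have zv : zeta ^+ v * (zeta ^+ v)^* = 1 by rewrite -cabs_sqr cabs_zeta expr1n.
have -> : \sum_(0 <= x < q) (zeta ^+ (u * x) * (zeta ^+ (v * x))^*) = \sum_(0 <= x < q) w ^+ x.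
  by apply: eq_bigr => x _; rewrite /w exprMn !exprM -rmorphXn.
have wE : (w == 1) = (u == v %[mod q]).
  rewrite -(eq_prim_root_expr zeta_prim) /w; apply/eqP/eqP => [e|->//].
  have : zeta ^+ v * (zeta ^+ u * (zeta ^+ v)^*) = zeta ^+ v by rewrite e mulr1.
  by rewrite mulrCA zv mulr1.
case: ifP => uv; last first.
  apply: sum_unity_root; last by rewrite wE uv.
  by rewrite /w exprMn -rmorphXn -!exprM ![(_ * q)%N]mulnC !exprM (prim_expr_order zeta_prim) !expr1n rmorph1 mulr1.
rewrite -wE in uv; rewrite (eqP uv).
under eq_bigr do rewrite expr1n.
by rewrite big_const_nat subn0 iter_addr_0.
Qed.

Lemma second_moment_le (A : finType) (D : pred A) (c : A -> R[i]) (phi : A -> nat) :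
  (forall a, D a -> cabs (c a) <= 1) ->
  \sum_(0 <= x < q) cabs (\sum_(a | D a) c a * zeta ^+ (phi a * x)) ^+ 2
   <= (q * \sum_(a | D a) \sum_(b | D b) (phi a == phi b %[mod q]))%N%:R.
Proof.
move=> c1.
have E : (\sum_(0 <= x < q) cabs (\sum_(a | D a) c a * zeta ^+ (phi a * x)) ^+ 2)%:C =
  \sum_(a | D a) \sum_(b | D b) (c a * (c b)^*) * (if phi a == phi b %[mod q] then q%:R else 0).
  rewrite rmorph_sum /=; under eq_bigr do rewrite cabs_sqr rmorph_sum mulr_suml.
  rewrite exchange_big /=; apply: eq_bigr => a _.
  under eq_bigr do rewrite mulr_sumr.
  rewrite exchange_big /=; apply: eq_bigr => b _.
  rewrite -zeta_orthogonality mulr_sumr; apply: eq_bigr => x _.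
  by rewrite rmorphM /=; ring.
have Sge0 : 0 <= \sum_(0 <= x < q) cabs (\sum_(a | D a) c a * zeta ^+ (phi a * x)) ^+ 2.
  by apply: sumr_ge0 => x _; apply: sqr_ge0.
rewrite -[leLHS]ger0_norm // -cabs_real E.
apply: le_trans (cabs_sum _ _ _) _; rewrite natrM natr_sum mulr_sumr.
apply: ler_sum => a Da; apply: le_trans (cabs_sum _ _ _) _.
rewrite natr_sum mulr_sumr; apply: ler_sum => b Db.
rewrite !cabsM; have -> : cabs (c b)^* = cabs (c b) by rewrite /cabs normcJ.
case: ifP => _ /=; last by rewrite cabs0 !mulr0.
have -> : cabs q%:R = q%:R by rewrite -(rmorph_nat (real_complex R)) cabs_real ger0_norm.
rewrite mulr1 ler_piMl // mulr_ile1 ?cabs_ge0 ?c1 //.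
Qed.

(** The additive energy of order k of the values of [phi] modulo q. The tuples are finite functions
    so that distributivity expands a k-th power directly into a sum over them. *)
Definition energy (X : nat) (Q : pred nat) (phi : nat -> nat) (k : nat) : nat :=
  \sum_(s : {ffun 'I_k -> 'I_X} | s \in ffun_on [pred p : 'I_X | Q p])
  \sum_(t : {ffun 'I_k -> 'I_X} | t \in ffun_on [pred p : 'I_X | Q p])
   (\sum_(i < k) phi (s i) == \sum_(i < k) phi (t i) %[mod q]).

(** The k-th power of the sum is again an exponential sum, over k-tuples and with coefficients
    bounded by 1, so orthogonality in the form of [second_moment_le] applies to it. *)
Lemma even_moment_le (X : nat) (Q : pred nat) (c : nat -> R[i]) (phi : nat -> nat) (k : nat) :
  (forall p, Q p -> cabs (c p) <= 1) ->
  \sum_(0 <= x < q) cabs (\sum_(0 <= p < X | Q p) c p * zeta ^+ (phi p * x)) ^+ (2 * k)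
   <= (q * energy X Q phi k)%N%:R.
Proof.
move=> c1.
have := @second_moment_le {ffun 'I_k -> 'I_X}
  (fun s => s \in ffun_on [pred p : 'I_X | Q p])
  (fun s => \prod_(i < k) c (s i)) (fun s => \sum_(i < k) phi (s i))%N.
have h (s : {ffun 'I_k -> 'I_X}) : s \in ffun_on [pred p : 'I_X | Q p] ->
    cabs (\prod_(i < k) c (s i)) <= 1.
  move=> /ffun_onP sQ; rewrite cabs_prod.
  by apply: prodr_ile1 => i _; rewrite cabs_ge0 c1 //; have := sQ i.
move=> /(_ h); apply: le_trans; apply: ler_sum => x _.
rewrite mulnC exprM -cabsX.
have powE (z : R[i]) : z ^+ k = \prod_(i < k) z by rewrite prodr_const card_ord.
rewrite big_mkord powE.
rewrite (bigA_distr_big _ (fun _ (p : 'I_X) => c p * zeta ^+ (phi p * x))) /=.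
rewrite le_eqVlt; apply/orP; left; apply/eqP; congr (cabs _ ^+ 2).
apply: eq_bigr => s _; by rewrite big_split big_distrl /= (big_morph _ (exprD zeta) (expr0 zeta)).
Qed.
End Moments.
End ComplexAbs.

Local Open Scope nat_scope.

(** * Congruences between sums of reciprocals of primes *)

Section Energy.
Variables (q : nat) (inv : nat -> nat).
Hypothesis invP : forall n, 0 < n -> coprime n q -> inv n * n = 1 %[mod q].

Lemma inv_congr (m n : nat) : 0 < m -> coprime m q -> 0 < n -> coprime n q ->
  inv m = inv n %[mod q] -> m = n %[mod q].
Proof.
move=> m0 cm n0 cn e.
have h1 : inv n * n * m = m %[mod q] by rewrite -modnMml invP // modnMml mul1n.
have h2 : inv m * m * n = n %[mod q] by rewrite -modnMml invP // modnMml mul1n.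
by rewrite -h1 -h2 -mulnA -modnMml -e modnMml [n * m]mulnC mulnA.
Qed.

Lemma energy_one_le (X : nat) (Q : pred nat) (K : nat) :
  (forall p, Q p -> prime p /\ coprime p q) ->
  (forall a, Q a -> \sum_(0 <= p < X | Q p && (p == a %[mod q])) 1 <= K) ->
  energy q X Q inv 1 <= (\sum_(0 <= p < X | Q p) 1) * K.
Proof.
move=> Qp QK; rewrite /energy.
pose F (a b : 'I_X) : nat := (inv a == inv b %[mod q]).
(* Functions on a one-element type are traded for their value by distributivity over a product with
   a single factor. *)
have E1 (H : 'I_X -> nat) : \sum_(t : {ffun 'I_1 -> 'I_X} | t \in ffun_on [pred p : 'I_X | Q p]) H (t ord0)
   = \sum_(p < X | Q p) H p.
  have := @bigA_distr_big nat 0 1 muln addn _ _ [pred p : 'I_X | Q p] (fun (_ : 'I_1) p => H p).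
  by rewrite big_ord1 => ->; apply: eq_bigr => t _; rewrite big_ord1.
rewrite (eq_bigr (fun s : {ffun 'I_1 -> 'I_X} => \sum_(p < X | Q p) F (s ord0) p)); last first.
  by move=> s _; rewrite -E1; apply: eq_bigr => t _; rewrite !big_ord1.
rewrite (E1 (fun a => \sum_(p < X | Q p) F a p)) big_mkord big_distrl /=.
apply: leq_sum => a Qa; rewrite mul1n; apply: leq_trans (QK a Qa).
rewrite big_mkord [X in X <= _]big_mkcond [X in _ <= X]big_mkcond /=.
apply: leq_sum => p _; case: ifP => //= Qpp.
rewrite /F; case: eqP => // e.
have [pa ca] := Qp _ Qa; have [pp cp] := Qp _ Qpp.
by have /eqP ap := inv_congr (prime_gt0 pa) ca (prime_gt0 pp) cp e; rewrite eq_sym ap.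
Qed.

(* The hypothesis is sum_i 1 / s_i = sum_i 1 / t_i with denominators cleared.
   If p = t_{i0} were none of the s_i, then 1 / p would occur r times on the
   right, with 0 < r <= k < p, and the two sides would have different p-adic
   valuations. *)
Lemma prime_recip_sum_val (k : nat) (s t : 'I_k -> nat) (i0 : 'I_k) :
  (forall i, prime (s i)) -> (forall i, prime (t i)) -> k < t i0 ->
  \sum_(i < k) (\prod_(j < k | j != i) s j) * \prod_(j < k) t j =
  \sum_(i < k) (\prod_(j < k | j != i) t j) * \prod_(j < k) s j ->
  exists i, s i = t i0.
Proof.
move=> ps pt kt e; set p := t i0 in kt *; have pp : prime p := pt i0.
have [/existsP[i /eqP <-]|] := boolP [exists i, s i == p]; first by exists i.
rewrite negb_exists => /forallP ns; exfalso.
pose r := #|[pred j | t j == p]|.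
pose T' := \prod_(j < k | t j != p) t j.
have TE : \prod_(j < k) t j = p ^ r * T'.
  rewrite (bigID (fun j => t j == p)) /=; congr (_ * _).
  by rewrite -prod_nat_const; apply: eq_bigr => j /eqP.
have r0 : 0 < r by apply/card_gt0P; exists i0; rewrite inE.
have rk : r <= k by rewrite -[k in _ <= k]card_ord max_card.
have p0 := prime_gt0 pp.
have cS : coprime (p ^ r) (\prod_(j < k) s j).
  apply: coprimeXl; rewrite prime_coprime // Euclid_dvd_prod // big_has.
  apply/hasPn => j _; rewrite dvdn_prime2 // eq_sym; exact: ns.
have cT : coprime p T'.
  rewrite prime_coprime // Euclid_dvd_prod // big_has_cond.
  apply/hasPn => j _ /=; apply/negP => /andP[tj].
  by rewrite dvdn_prime2 // eq_sym (negbTE tj).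
have dT i : t i * (\prod_(j < k | j != i) t j) = p ^ r * T'.
  by rewrite -TE [RHS](bigD1 i).
have : p ^ r %| \sum_(i < k) \prod_(j < k | j != i) t j.
  rewrite -(Gauss_dvdl _ cS) big_distrl /= -e -big_distrl /= TE.
  by rewrite dvdn_mull // dvdn_mulr.
rewrite (bigID (fun j => t j == p)) /= dvdn_addl; last first.
  apply: dvdn_sum => i ti.
  have ci : coprime (p ^ r) (t i).
    by apply: coprimeXl; rewrite prime_coprime // dvdn_prime2 // eq_sym.
  by rewrite -(Gauss_dvdr _ ci) dT dvdn_mulr.
have -> : \sum_(i < k | t i == p) \prod_(j < k | j != i) t j = r * (p ^ r.-1 * T').
  rewrite -sum_nat_const; apply: eq_bigr => i /eqP ti.
  apply/eqP; rewrite -(eqn_pmul2l p0) -{1}ti dT mulnA -expnS prednK //.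
rewrite mulnCA -{1}(prednK r0) expnSr dvdn_pmul2l ?expn_gt0 ?p0 //.
rewrite Gauss_dvdl // => /dvdn_leq; rewrite r0 => /(_ isT); lia.
Qed.

(** Multiplying by all the primes clears the inverses. Each side becomes a sum of k products of 2k -
    1 primes, hence is below q, so the congruence is an equality of integers. *)
Lemma energy_diagonal (k Bd : nat) (s t : 'I_k -> nat) :
  (forall i, [/\ prime (s i), coprime (s i) q & s i <= Bd]) ->
  (forall i, [/\ prime (t i), coprime (t i) q, k < t i & t i <= Bd]) ->
  k * Bd ^ (2 * k).-1 < q ->
  \sum_(i < k) inv (s i) = \sum_(i < k) inv (t i) %[mod q] ->
  forall i, exists j, s j = t i.
Proof.
move=> hs ht kq e i0.
apply: prime_recip_sum_val => [i|i||].
- by have [] := hs i.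
- by have [] := ht i.
- by have [] := ht i0.
have k0 : 0 < k by apply: leq_ltn_trans (ltn_ord i0).
have small (u v : 'I_k -> nat) : (forall i, u i <= Bd) -> (forall i, v i <= Bd) ->
   \sum_(i < k) (\prod_(j < k | j != i) u j) * \prod_(j < k) v j < q.
  move=> hu hv; apply: leq_ltn_trans kq.
  have -> : k * Bd ^ (2 * k).-1 = \sum_(i < k) Bd ^ (2 * k).-1 by rewrite sum_nat_const card_ord.
  apply: leq_sum => i _.
  have -> : (2 * k).-1 = k.-1 + k by lia.
  rewrite expnD; apply: leq_mul.
    apply: (@leq_trans (\prod_(j < k | j != i) Bd)); first exact: leq_prod.
    by rewrite prod_nat_const cardC1 card_ord.
  apply: (@leq_trans (\prod_(j < k) Bd)); first exact: leq_prod.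
  by rewrite prod_nat_const card_ord.
have red (u v : 'I_k -> nat) : (forall i, prime (u i)) -> (forall i, coprime (u i) q) ->
   \sum_(i < k) (\prod_(j < k | j != i) u j) * \prod_(j < k) v j =
   (\prod_(j < k) u j * \prod_(j < k) v j) * \sum_(i < k) inv (u i) %[mod q].
  move=> pu cu; rewrite big_distrr /=.
  elim/big_ind2: _ => // [x1 x2 y1 y2 e1 e2|i _]; first by rewrite -modnDm e1 e2 modnDm.
  rewrite [\prod_(j < k) u j](bigD1 i) //=; set a := \prod_(j < k | j != i) u j.
  have -> : u i * a * \prod_(j < k) v j * inv (u i) = (inv (u i) * u i) * (a * \prod_(j < k) v j) by ring.
  by rewrite -[RHS]modnMml invP ?prime_gt0 // modnMml mul1n.
have sm1 : \sum_(i < k) (\prod_(j < k | j != i) s j) * \prod_(j < k) t j < q.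
  by apply: small => i; [have [] := hs i|have [] := ht i].
have sm2 : \sum_(i < k) (\prod_(j < k | j != i) t j) * \prod_(j < k) s j < q.
  by apply: small => i; [have [] := ht i|have [] := hs i].
rewrite -(modn_small sm1) -(modn_small sm2).
rewrite !red; try by move=> i; have [] := hs i.
- by rewrite -modnMmr e modnMmr [X in X * _]mulnC.
- by move=> i; have [] := ht i.
- by move=> i; have [] := ht i.
Qed.

(* By [energy_diagonal] a solution is determined by s together with the choice
   of each t_i among the at most k values of s. *)
Lemma energy_le (X : nat) (Q : pred nat) (k Bd : nat) :
  (forall p, Q p -> [/\ prime p, coprime p q, k < p & p <= Bd]) ->
  k * Bd ^ (2 * k).-1 < q ->
  energy q X Q inv k <= (\sum_(0 <= p < X | Q p) 1) ^ k * k ^ k.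
Proof.
move=> hQ kq.
have cQ : \sum_(0 <= p < X | Q p) 1 = #|[pred p : 'I_X | Q p]|.
  by rewrite big_mkord sum1_card.
rewrite cQ -{2}[k]card_ord -card_ffun_on -sum_nat_const.
apply: leq_sum => s /ffun_onP sQ.
apply: (@leq_trans #|ffun_on (mem (codom s)) : pred {ffun 'I_k -> 'I_X}|); last first.
  have ck : #|codom s| <= k.
    by rewrite (leq_trans (card_size _)) // size_codom card_ord.
  rewrite card_ffun_on card_ord; move: ck; set c := #|_| => ck.
  by case: (posnP k) => [e|k0]; [rewrite e !expn0|rewrite leq_exp2r].
rewrite -sum1_card [X in X <= _]big_mkcond [X in _ <= X]big_mkcond /=.
apply: leq_sum => t _; case: ifP => // /ffun_onP tQ.
case: eqP => // e.
have -> // : t \in ffun_on (mem (codom s)).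
apply/ffun_onP => i.
have hs j : [/\ prime (s j), coprime (s j) q & s j <= Bd] by have /hQ[] := sQ j.
have ht j : [/\ prime (t j), coprime (t j) q, k < t j & t j <= Bd] by have /hQ[] := tQ j.
have [j] := energy_diagonal hs ht kq e i.
by move=> /val_inj <-; apply: codom_f.
Qed.
End Energy.

Local Open Scope ring_scope.
Local Open Scope complex_scope.

Lemma young_pow (R : realFieldType) (u : R) (n : nat) : 0 <= u -> (0 < n)%N ->
  n%:R * u <= u ^+ n + n%:R - 1.
Proof.
move=> u0; case: n => // n _; elim: n => [|n IH]; first by rewrite expr1; lra.
rewrite exprS -[n.+2]addn1 natrD.
have : u * (n.+1%:R * u) <= u * (u ^+ n.+1 + n.+1%:R - 1) by rewrite ler_wpM2l.
have : 0 <= n.+1%:R * (u - 1) ^+ 2 by rewrite mulr_ge0 ?sqr_ge0.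
nra.
Qed.

Section Block.
Variables (R : rcfType) (q : nat) (zeta : R[i]) (inv : nat -> nat).
Hypothesis zeta_prim : q.-primitive_root zeta.
Hypothesis invP : forall n, (0 < n)%N -> coprime n q -> (inv n * n = 1 %[mod q])%N.

Let q_gt0 : (0 < q)%N. Proof. exact: prim_order_gt0 zeta_prim. Qed.

(** Inversion is injective modulo q, so a residue is the inverse of at most M / q + 1 values of m.
    For q > M the completion loses about q / M, a loss that only high moments can absorb. *)
Lemma sum_over_inverses (Phi : nat -> R) (M : nat) :
  (forall x, 0 <= Phi x) -> (forall x, Phi (x %% q)%N = Phi x) ->
  \sum_(1 <= m < M.+1 | coprime m q) Phi (inv m)
    <= (M %/ q + 1)%N%:R * \sum_(0 <= x < q) Phi x.
Proof.
move=> P0 Pq.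
have -> : \sum_(1 <= m < M.+1 | coprime m q) Phi (inv m) =
   \sum_(1 <= m < M.+1 | coprime m q) \sum_(0 <= x < q) (inv m %% q == x)%N%:R * Phi x.
  apply: eq_bigr => m _.
  rewrite (bigD1_seq (inv m %% q)%N) ?iota_uniq ?mem_index_iota ?ltn_pmod //=.
  rewrite eqxx mul1r Pq big1 ?addr0 // => x.
  by rewrite eq_sym => /negbTE ->; rewrite mul0r.
rewrite exchange_big /= mulr_sumr; apply: ler_sum => x _.
rewrite -mulr_suml ler_wpM2r // -natr_sum ler_nat.
case: (boolP (has (fun m => coprime m q && (inv m %% q == x)) (index_iota 1 M.+1)))%N.
  move=> /hasP[m0]; rewrite mem_index_iota => /andP[m01 _] /andP[c0 /eqP i0].
  have := @sum_residue_le q m0 1 M q_gt0; rewrite add1n; apply: leq_trans.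
  rewrite [leqLHS]big_mkcond [leqRHS]big_mkcond /=.
  rewrite [leqLHS]big_nat [leqRHS]big_nat; apply: leq_sum => m /andP[m1 _].
  case: ifP => // cm; case: eqP => // im.
  by rewrite (inv_congr invP m1 cm m01 c0) ?eqxx // im i0.
move=> /hasPn no; rewrite big1_seq // => m /andP[cm mi].
by have := no m mi; rewrite cm /= => /negbTE ->.
Qed.

(* Young's inequality 2k u <= u^(2k) + 2k - 1 at u = T / Y plays the part of
   Hoelder's inequality. *)
Lemma block_bound (X : nat) (Q : pred nat) (c : nat -> R[i]) (M k : nat) (Y : R) :
  (forall p, Q p -> cabs (c p) <= 1) -> (0 < k)%N -> 0 < Y ->
  ((M %/ q + 1) * q * energy q X Q inv k)%N%:R <= M%:R * Y ^+ (2 * k) ->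
  \sum_(1 <= m < M.+1 | coprime m q)
     cabs (\sum_(0 <= p < X | Q p) c p * zeta ^+ (inv p * inv m)) <= M%:R * Y.
Proof.
move=> c1 k0 Y0 hE.
pose T x := cabs (\sum_(0 <= p < X | Q p) c p * zeta ^+ (inv p * x)).
have T0 x : 0 <= T x by apply: cabs_ge0.
have k20 : (0 < 2 * k)%N by rewrite muln_gt0.
have sumT : \sum_(1 <= m < M.+1 | coprime m q) T (inv m) ^+ (2 * k) <= M%:R * Y ^+ (2 * k).
  apply: le_trans hE; apply: le_trans (sum_over_inverses (Phi := fun x => T x ^+ (2 * k)) _ _ _) _.
  - by move=> x; apply: exprn_ge0.
  - move=> x; congr (cabs _ ^+ _); apply: eq_bigr => p _; congr (_ * _).
    by rewrite !(mulnC (inv p)) !exprM (prim_expr_mod zeta_prim).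
  rewrite -mulnA natrM ler_wpM2l //.
  exact: (even_moment_le zeta_prim).
have cM : \sum_(1 <= m < M.+1 | coprime m q) 1 <= M%:R :> R.
  rewrite big_mkcond; apply: (@le_trans _ _ (\sum_(1 <= m < M.+1) 1)).
    by apply: ler_sum => m _; case: ifP.
  by rewrite big_const_nat iter_addr_0 subSS subn0.
have : \sum_(1 <= m < M.+1 | coprime m q) (2 * k)%:R * (T (inv m) / Y) <=
    \sum_(1 <= m < M.+1 | coprime m q) ((T (inv m) ^+ (2 * k)) / Y ^+ (2 * k) + ((2 * k)%:R - 1) * 1).
  apply: ler_sum => m _; rewrite mulr1.
  have := @young_pow _ (T (inv m) / Y) (2 * k); rewrite divr_ge0 ?T0 ?(ltW Y0) //.
  by move=> /(_ isT k20); rewrite expr_div_n; lra.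
rewrite big_split /= -!mulr_sumr -!mulr_suml.
set S := \sum_(_ <= _ < _ | _) T _; set S2 := \sum_(_ <= _ < _ | _) T _ ^+ _ in sumT *.
set C1 := \sum_(_ <= _ < _ | _) 1 in cM *.
have : S2 / Y ^+ (2 * k) <= M%:R by rewrite ler_pdivrMr ?exprn_gt0.
have k1 : 1 <= (2 * k)%:R :> R by rewrite ler1n.
set K := (2 * k)%:R in k1 *.
move=> h1 h2; change (S <= M%:R * Y).
rewrite -ler_pdivrMr //.
have : K * (S / Y) <= K * M%:R by nra.
by rewrite ler_pM2l // (lt_le_trans ltr01).
Qed.

End Block.

(** * Reduction to bilinear sums over blocks *)

Lemma sum_multiples (V : nmodType) (F : nat -> V) (p n : nat) : (0 < p)%N ->
  \sum_(1 <= m < n.+1 | (p %| m)%N) F m = \sum_(1 <= m < (n %/ p).+1) F (p * m)%N.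
Proof.
move=> p0; elim: n => [|n IH]; first by rewrite div0n !big_geq.
rewrite big_mkcond big_nat_recr //= -big_mkcond /= IH divnS //.
case: (boolP (p %| n.+1)%N) => pn /=; last by rewrite add0n addr0.
have e : (p * (n %/ p).+1 = n.+1)%N.
  by rewrite -[RHS](divnK pn) divnS // pn add1n mulnC.
by rewrite add1n [RHS]big_nat_recr //= e.
Qed.

Lemma sum_select (V : nmodType) (G : nat -> V) (a b x : nat) : (a <= x < b)%N ->
  \sum_(a <= i < b) (if x == i then G i else 0) = G x.
Proof.
move=> ab; rewrite (bigD1_seq x) ?iota_uniq ?mem_index_iota //= eqxx.
by rewrite big1 ?addr0 // => i; rewrite eq_sym => /negbTE ->.
Qed.

Section Reduction.
Variables (R : rcfType) (q : nat) (zeta : R[i]) (inv : nat -> nat).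
Hypothesis zeta_prim : q.-primitive_root zeta.
Hypothesis invP : forall n, (0 < n)%N -> coprime n q -> (inv n * n = 1 %[mod q])%N.
Variable f : nat -> R[i].
Hypothesis fM : forall m n, (0 < m)%N -> (0 < n)%N -> coprime m n -> f (m * n)%N = f m * f n.
Hypothesis f_le1 : forall n, (0 < n)%N -> cabs (f n) <= 1.
Variables (n J i0 i1 : nat).
Hypothesis J_gt0 : (0 < J)%N.
Hypothesis leXn : (2 ^ i1 <= n)%N.

Definition window_prime (p : nat) : bool := [&& (2 ^ i0 <= p)%N, prime p & coprime p q].
(* On the window the index c = floor(p J / 2^i) runs over [J, 2J): a block is
   an interval of ratio at most 1 + 1/J, so that replacing the range m <= n / p
   by the range m <= block_cut i c, common to the block, costs a proportion 1/J. *)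
Definition block_prime (i c p : nat) : bool :=
  [&& window_prime p, trunc_log 2 p == i & ((p * J) %/ 2 ^ i)%N == c].
Definition block_cut (i c : nat) : nat := ((n * J) %/ (2 ^ i * c.+1))%N.

Let L : R := recip_sum R (2 ^ i1) window_prime.
(** [g] is the summand under study; [h p m] is the value which full multiplicativity would give to
    [g (p * m)]. The two differ only when p divides m. *)
Let g (m : nat) : R[i] := if coprime m q then f m * zeta ^+ inv m else 0.
Let h (p m : nat) : R[i] :=
  if coprime m q then f m * (f p * zeta ^+ (inv p * inv m)) else 0.

Lemma window_prime_prime p : window_prime p -> prime p. Proof. by case/and3P. Qed.

Lemma zeta_inv_mul (p m : nat) : (0 < p)%N -> (0 < m)%N -> coprime p q -> coprime m q ->
  zeta ^+ inv (p * m) = zeta ^+ (inv p * inv m).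
Proof.
move=> p0 m0 cp cm; apply/eqP; rewrite (eq_prim_root_expr zeta_prim).
have pm0 : (0 < p * m)%N by rewrite muln_gt0 p0.
have cpm : coprime (p * m) q by rewrite coprimeMl cp.
have e : (inv (p * m) * (p * m) = (inv p * inv m) * (p * m) %[mod q])%N.
  rewrite invP //; have -> : (inv p * inv m * (p * m) = (inv p * p) * (inv m * m))%N by ring.
  by rewrite -modnMm !invP // modnMm.
have e2 : (inv (p * m) * (p * m) * inv (p * m) = inv (p * m) %[mod q])%N.
  by rewrite -modnMml invP // modnMml mul1n.
have e3 : (inv p * inv m * (p * m) * inv (p * m) = inv p * inv m %[mod q])%N.
  have -> : (inv p * inv m * (p * m) * inv (p * m) = inv (p * m) * (p * m) * (inv p * inv m))%N by ring.
  by rewrite -modnMml invP // modnMml mul1n.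
by rewrite -e2 -e3 -modnMml e modnMml.
Qed.

Lemma g_le1 m : (0 < m)%N -> cabs (g m) <= 1.
Proof.
move=> m0; rewrite /g; case: ifP => _; last by rewrite cabs0.
by rewrite cabsM (cabs_zeta zeta_prim) mulr1 f_le1.
Qed.

Lemma h_le1 p m : (0 < p)%N -> (0 < m)%N -> cabs (h p m) <= 1.
Proof.
move=> p0 m0; rewrite /h; case: ifP => _; last by rewrite cabs0.
by rewrite !cabsM (cabs_zeta zeta_prim) mulr1 mulr_ile1 ?cabs_ge0 ?f_le1.
Qed.

Lemma gh_le p m : window_prime p -> (0 < m)%N ->
  cabs (g (p * m) - h p m) <= 2 * (p %| m)%N%:R.
Proof.
move=> kp m0; have /and3P[_ pp cp] := kp; have p0 := prime_gt0 pp.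
case: (boolP (p %| m)%N) => pm.
  rewrite mulr1; apply: le_trans (cabsD _ _) _; rewrite cabsN.
  have := @g_le1 (p * m); rewrite muln_gt0 p0 m0 => /(_ isT).
  have := h_le1 p0 m0; lra.
rewrite mulr0 /g /h coprimeMl cp /=; case: ifP => cm; last by rewrite subr0 cabs0.
rewrite fM ?prime_coprime // zeta_inv_mul //.
have -> : f p * f m * zeta ^+ (inv p * inv m) - f m * (f p * zeta ^+ (inv p * inv m)) = 0 by ring.
by rewrite cabs0.
Qed.

Lemma window_prime_inv_le p : window_prime p -> p%:R^-1 <= (2 ^ i0)%:R^-1 :> R.
Proof.
move=> /and3P[ip pp _].
rewrite lef_pV2 ?posrE ?ltr0n ?expn_gt0 ?prime_gt0 // ler_nat //.
Qed.

(** For each p, the error comes from the multiples of p among m <= n / p. There are at most n / p^2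
    of them, and one factor 1 / p is at most 1 / 2^i0. *)
Lemma sum_omega_split :
  cabs (\sum_(1 <= m < n.+1) (omega_count R (2 ^ i1) window_prime m)%:C * g m
    - \sum_(0 <= p < 2 ^ i1 | window_prime p) \sum_(1 <= m < (n %/ p).+1) h p m)
  <= 2 * n%:R * L / (2 ^ i0)%:R.
Proof.
have -> : \sum_(1 <= m < n.+1) (omega_count R (2 ^ i1) window_prime m)%:C * g m =
    \sum_(0 <= p < 2 ^ i1 | window_prime p) \sum_(1 <= m < (n %/ p).+1) g (p * m)%N.
  under eq_bigr do rewrite rmorph_sum mulr_suml /=.
  rewrite exchange_big /=; apply: eq_bigr => p kp.
  rewrite -(@sum_multiples _ g p n (prime_gt0 (window_prime_prime kp))) [RHS]big_mkcond.
  by apply: eq_bigr => m _; case: (p %| m)%N; rewrite ?mul1r ?mul0r.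
rewrite -sumrB; apply: le_trans (cabs_sum _ _ _) _.
rewrite /L /recip_sum mulr_sumr mulr_suml.
apply: ler_sum => p kp; rewrite -sumrB.
apply: le_trans (cabs_sum _ _ _) _.
apply: (@le_trans _ _ (\sum_(1 <= m < (n %/ p).+1) 2 * (p %| m)%N%:R)).
  rewrite big_nat [leRHS]big_nat; apply: ler_sum => m /andP[m0 _]; exact: gh_le.
rewrite -mulr_sumr natr_count_dvd.
have p0 : 0 < p%:R :> R by rewrite ltr0n (prime_gt0 (window_prime_prime kp)).
have h1 := natdiv_le R (n %/ p) p; have h2 := natdiv_le R n p.
have h3 := window_prime_inv_le kp.
have h4 : (n %/ p %/ p)%N%:R <= n%:R / p%:R / p%:R :> R.
  by apply: le_trans h1 _; rewrite ler_pM2r ?invr_gt0.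
have : 0 <= n%:R / p%:R :> R by rewrite divr_ge0.
move: h4 h3; set a := _ %:R : R; set b := n%:R; set x := p%:R^-1; set y := _^-1.
move=> h4 h3 h5; have : b * x * x <= b * x * y by rewrite ler_wpM2l.
nra.
Qed.

Lemma block_cut_le p i c : (0 < p)%N -> ((p * J) %/ 2 ^ i)%N = c -> (block_cut i c <= n %/ p)%N.
Proof.
move=> p0 ec; have i0' : (0 < 2 ^ i)%N by rewrite expn_gt0.
rewrite leq_divRL // /block_cut.
have h1 : (p * J < 2 ^ i * c.+1)%N by rewrite [(2 ^ i * _)%N]mulnC -ltn_divLR // ec.
set D := (2 ^ i * c.+1)%N in h1 *.
have h2 := leq_trunc_div (n * J) D.
set M := (_ %/ D)%N in h2 *.
rewrite -(@leq_pmul2r J) //; apply: leq_trans h2.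
by rewrite -mulnA leq_mul2l (ltnW h1) orbT.
Qed.

(** On the block p J >= 2^i c, so before rounding the cut is at least c / (c + 1) times n / p, and c
    >= J. *)
Lemma block_cut_ge p i c : (0 < p)%N -> ((p * J) %/ 2 ^ i)%N = c -> (J <= c)%N ->
  (n %/ p)%N%:R - (block_cut i c)%:R <= n%:R / p%:R / J%:R + 1 :> R.
Proof.
move=> p0 ec Jc; have i0' : (0 < 2 ^ i)%N by rewrite expn_gt0.
have h2 := natdiv_le R n p.
have D0 : (0 < 2 ^ i * c.+1)%N by rewrite muln_gt0 i0'.
have h1 := @natdiv_ge R (n * J) (2 ^ i * c.+1) D0.
have h3 : (2 ^ i * c <= p * J)%N by rewrite mulnC -ec leq_trunc_div.
have h3' : (2 ^ i)%:R * c%:R <= p%:R * J%:R :> R by rewrite -!natrM ler_nat.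
suff : n%:R / p%:R <= n%:R / p%:R / J%:R + (n * J)%N%:R / (2 ^ i * c.+1)%N%:R :> R.
  rewrite /block_cut; move: h1 h2.
  set x := (n * J)%:R / _; set y := (_ %/ _)%:R; set v := (n %/ p)%:R.
  set a := n%:R / p%:R; set u := a / _; lra.
rewrite !natrM.
have p0' : 0 < p%:R :> R by rewrite ltr0n.
have J0' : 0 < J%:R :> R by rewrite ltr0n.
have i0'' : 0 < (2 ^ i)%:R :> R by rewrite ltr0n.
have c0' : 0 < c.+1%:R :> R by rewrite ltr0n.
have Jc' : J%:R <= c%:R :> R by rewrite ler_nat.
rewrite -[c.+1]addn1 natrD in c0' *.
have -> : n%:R / p%:R / J%:R + n%:R * J%:R / ((2 ^ i)%:R * (c%:R + 1)) =
   n%:R / p%:R * (J%:R^-1 + p%:R * J%:R / ((2 ^ i)%:R * (c%:R + 1))) :> R.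
  by field; rewrite !gt_eqF.
rewrite ler_peMr // ?divr_ge0 //.
have a1 : (c%:R + 1)^-1 <= J%:R^-1 :> R by rewrite lef_pV2 ?posrE //; lra.
have a2 : c%:R / (c%:R + 1) <= p%:R * J%:R / ((2 ^ i)%:R * (c%:R + 1)) :> R.
  have -> : p%:R * J%:R / ((2 ^ i)%:R * (c%:R + 1)) = p%:R * J%:R / (2 ^ i)%:R / (c%:R + 1) :> R.
    by field; rewrite !gt_eqF.
  by rewrite ler_pM2r ?invr_gt0 // ler_pdivlMr // mulrC.
have a3 : c%:R / (c%:R + 1) = 1 - (c%:R + 1)^-1 :> R by field; rewrite gt_eqF.
lra.
Qed.

Lemma trunc_block p : window_prime p -> (p < 2 ^ i1)%N ->
  (i0 <= trunc_log 2 p < i1)%N /\ (J <= (p * J) %/ 2 ^ trunc_log 2 p < 2 * J)%N.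
Proof.
move=> kp pX; have /and3P[ip pp _] := kp.
have /andP[lo hi] := @trunc_log_bounds 2 p isT (prime_gt0 pp).
split.
  rewrite trunc_log_max //=.
  by rewrite -(@ltn_exp2l 2) //; apply: leq_ltn_trans lo pX.
rewrite leq_divRL ?expn_gt0 // mulnC leq_mul2r lo orbT /=.
rewrite ltn_divLR ?expn_gt0 // mulnAC -expnS ltn_mul2r hi andbT //.
Qed.

Lemma sum_blocks (V : nmodType) (H : nat -> nat -> nat -> V) :
  \sum_(0 <= p < 2 ^ i1 | window_prime p) H (trunc_log 2 p) ((p * J) %/ 2 ^ trunc_log 2 p)%N p =
  \sum_(i0 <= i < i1) \sum_(J <= c < 2 * J) \sum_(0 <= p < 2 ^ i1 | block_prime i c p) H i c p.
Proof.
have -> : \sum_(i0 <= i < i1) \sum_(J <= c < 2 * J) \sum_(0 <= p < 2 ^ i1 | block_prime i c p) H i c p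
  = \sum_(i0 <= i < i1) \sum_(J <= c < 2 * J) \sum_(0 <= p < 2 ^ i1 | window_prime p)
      (if trunc_log 2 p == i then if (p * J %/ 2 ^ i == c)%N then H i c p else 0 else 0).
  apply: eq_bigr => i _; apply: eq_bigr => c _.
  rewrite big_mkcond [RHS]big_mkcond; apply: eq_bigr => p _.
  by rewrite /block_prime; case: window_prime; case: (_ == i); case: (_ == c).
under [RHS]eq_bigr do rewrite exchange_big /=.
rewrite [RHS]exchange_big /= [LHS]big_nat_cond [RHS]big_nat_cond.
apply: eq_bigr => p /andP[/andP[_ pX] kp].
have [hi hc] := trunc_block kp pX.
rewrite -[LHS](sum_select (fun c => H (trunc_log 2 p) c p) hc).
rewrite -[LHS](sum_select (fun i => \sum_(J <= c < 2 * J) if (p * J %/ 2 ^ i == c)%N then H i c p else 0) hi).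
by apply: eq_bigr => i _; case: (_ == i) => //; rewrite big1.
Qed.

Lemma sum_cut_le :
  cabs (\sum_(0 <= p < 2 ^ i1 | window_prime p) \sum_(1 <= m < (n %/ p).+1) h p m
   - \sum_(0 <= p < 2 ^ i1 | window_prime p) \sum_(1 <= m <
       (block_cut (trunc_log 2 p) (p * J %/ 2 ^ trunc_log 2 p)).+1) h p m)
  <= n%:R * L / J%:R + (2 ^ i1)%N%:R.
Proof.
rewrite -sumrB; apply: le_trans (cabs_sum _ _ _) _.
apply: (@le_trans _ _ (\sum_(0 <= p < 2 ^ i1 | window_prime p) (n%:R / p%:R / J%:R + 1))).
  rewrite [leLHS]big_nat_cond [leRHS]big_nat_cond.
  apply: ler_sum => p /andP[/andP[_ pX] kp].
  have p0 := prime_gt0 (window_prime_prime kp).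
  have [_ /andP[Jc _]] := trunc_block kp pX.
  apply: le_trans (block_cut_ge p0 (erefl _) Jc).
  have := block_cut_le p0 (erefl (p * J %/ 2 ^ trunc_log 2 p)%N).
  set M := block_cut _ _ => Mn.
  rewrite (@big_cat_nat _ _ _ M.+1) //= addrAC subrr add0r.
  apply: le_trans (cabs_sum _ _ _) _.
  apply: (@le_trans _ _ (\sum_(M.+1 <= m < (n %/ p).+1) 1)).
    rewrite [leLHS]big_nat [leRHS]big_nat; apply: ler_sum => m /andP[m0 _].
    by apply: h_le1 => //; apply: leq_trans m0.
  by rewrite big_const_nat iter_addr_0 subSS natrB.
rewrite big_split /= -!mulr_suml -mulr_sumr lerD2l.
rewrite big_mkcond; apply: (@le_trans _ _ (\sum_(0 <= p < 2 ^ i1) 1)).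
  by apply: ler_sum => p _; case: ifP.
by rewrite big_const_nat iter_addr_0 subn0.
Qed.

Lemma sum_blocks_le (Bd : nat -> nat -> R) :
  (forall i c, (i0 <= i < i1)%N -> (J <= c < 2 * J)%N ->
    \sum_(1 <= m < (block_cut i c).+1 | coprime m q)
      cabs (\sum_(0 <= p < 2 ^ i1 | block_prime i c p) f p * zeta ^+ (inv p * inv m)) <= Bd i c) ->
  cabs (\sum_(0 <= p < 2 ^ i1 | window_prime p) \sum_(1 <= m <
       (block_cut (trunc_log 2 p) (p * J %/ 2 ^ trunc_log 2 p)).+1) h p m)
  <= \sum_(i0 <= i < i1) \sum_(J <= c < 2 * J) Bd i c.
Proof.
move=> hB; rewrite (sum_blocks (fun i c p => \sum_(1 <= m < (block_cut i c).+1) h p m)).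
apply: le_trans (cabs_sum _ _ _) _; rewrite [leLHS]big_nat [leRHS]big_nat.
apply: ler_sum => i hi.
apply: le_trans (cabs_sum _ _ _) _; rewrite [leLHS]big_nat [leRHS]big_nat.
apply: ler_sum => c hc; apply: le_trans (hB i c hi hc).
rewrite exchange_big /=; apply: le_trans (cabs_sum _ _ _) _.
rewrite [leRHS]big_mkcond [leLHS]big_nat [leRHS]big_nat.
apply: ler_sum => m /andP[m0 _]; rewrite /h; case: ifP => _; last by rewrite big1 ?cabs0.
by rewrite -mulr_sumr cabsM ler_piMl ?cabs_ge0 ?f_le1.
Qed.

Lemma bilinear_reduction (Bd : nat -> nat -> R) : 0 < L ->
  (forall i c, (i0 <= i < i1)%N -> (J <= c < 2 * J)%N ->
    \sum_(1 <= m < (block_cut i c).+1 | coprime m q)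
      cabs (\sum_(0 <= p < 2 ^ i1 | block_prime i c p) f p * zeta ^+ (inv p * inv m)) <= Bd i c) ->
  L * cabs (\sum_(1 <= m < n.+1 | coprime m q) f m * zeta ^+ inv m) <=
    n%:R * (2 * J%:R + L / J%:R) + 2 * n%:R * L / (2 ^ i0)%:R
    + (n%:R * L / J%:R + (2 ^ i1)%N%:R) + \sum_(i0 <= i < i1) \sum_(J <= c < 2 * J) Bd i c.
Proof.
move=> L0 hB; rewrite big_mkcond -/(g _) /=.
have := sum_blocks_le hB; have := sum_cut_le; have := sum_omega_split.
set W := \sum_(1 <= m < n.+1) _ * g m; set H1 := \sum_(_ <= _ < _ | _) _.
set H2 := \sum_(_ <= _ < _ | _) _ => b1 b2 b3.
have J0 : 0 < J%:R :> R by rewrite ltr0n.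
have b0 : cabs (\sum_(1 <= m < n.+1) (omega_count R (2 ^ i1) window_prime m - L)%:C * g m)
    <= n%:R * (2 * J%:R + L / J%:R).
  apply: le_trans (sum_abs_omega_le window_prime_prime leXn J0 L0).
  apply: le_trans (cabs_sum _ _ _) _.
  rewrite [leLHS]big_nat [leRHS]big_nat; apply: ler_sum => m /andP[m0 _].
  by rewrite cabsM cabs_real ler_piMr // g_le1.
(* The pieces are, in order, the multiples p | m, the truncation, the block sums, and the deviation
   of [omega_count] from its mean L. *)
have e : L%:C * \sum_(1 <= m < n.+1) g m = (W - H1) + (H1 - H2) + H2
    - \sum_(1 <= m < n.+1) (omega_count R (2 ^ i1) window_prime m - L)%:C * g m.
  transitivity (W - \sum_(1 <= m < n.+1) (omega_count R (2 ^ i1) window_prime m - L)%:C * g m); last by ring.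
  rewrite mulr_sumr -sumrB; apply: eq_bigr => m _; rewrite rmorphB /=; ring.
rewrite -[X in X * _ <= _]ger0_norm ?(ltW L0) // -cabs_real -cabsM e.
apply: le_trans (cabsD _ _) _; rewrite cabsN.
have := cabsD (W - H1 + (H1 - H2)) H2; have := cabsD (W - H1) (H1 - H2).
move: b0 b1 b2 b3; set x0 := cabs _; set x1 := cabs _; set x2 := cabs _; set x3 := cabs _.
lra.
Qed.

End Reduction.

(** * Bilinear sums over a block *)

Lemma sum1_nat_sub (a b a' b' : nat) (P P' : pred nat) :
  (forall p, (a <= p < b)%N -> P p -> (a' <= p < b')%N && P' p) ->
  (\sum_(a <= p < b | P p) 1 <= \sum_(a' <= p < b' | P' p) 1)%N.
Proof.
move=> H; rewrite !sum1_count -!size_filter; apply: uniq_leq_size.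
  by rewrite filter_uniq // iota_uniq.
move=> p; rewrite !mem_filter !mem_index_iota => /andP[Pp ab].
by rewrite andbC; apply: H.
Qed.

Lemma block_prime_dyadic (q J i0 i c p : nat) : block_prime q J i0 i c p ->
  [/\ prime p, coprime p q, (2 ^ i <= p)%N & (p < 2 ^ i.+1)%N].
Proof.
case/and3P=> /and3P[_ pp cp] /eqP <- _.
by have /andP[-> ->] := @trunc_log_bounds 2 p isT (prime_gt0 pp).
Qed.

Lemma block_prime_size (q J i0 i1 i c : nat) :
  (\sum_(0 <= p < 2 ^ i1 | block_prime q J i0 i c p) 1 <= 2 ^ i)%N.
Proof.
apply: (@leq_trans (\sum_(2 ^ i <= p < 2 ^ i.+1 | true) 1)).
  by apply: sum1_nat_sub => p _ /block_prime_dyadic[_ _ -> ->].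
by rewrite sum1_count count_predT size_iota expnS; lia.
Qed.

Lemma block_cut_lower (n J i c i1 : nat) : (0 < J)%N -> (i < i1)%N -> (c < 2 * J)%N ->
  (2 ^ i1 <= n)%N -> (0 < block_cut n J i c)%N /\ (n < block_cut n J i c * 2 ^ i.+2)%N.
Proof.
move=> J0 ii cJ Xn.
have D0 : (0 < 2 ^ i * c.+1)%N by rewrite muln_gt0 expn_gt0.
have le1 : (2 ^ i.+1 <= n)%N by apply: leq_trans Xn; rewrite leq_exp2l.
have DJ : (2 ^ i * c.+1 <= 2 ^ i.+1 * J)%N.
  by rewrite expnSr -mulnA leq_mul2l cJ orbT.
have M0 : (0 < block_cut n J i c)%N.
  by rewrite /block_cut divn_gt0 //; apply: leq_trans DJ _; rewrite leq_mul2r le1 orbT.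
split => //.
have := ltn_ceil (n * J) D0; rewrite -/(block_cut n J i c) => h1.
have : (n * J < (block_cut n J i c).+1 * (2 ^ i.+1 * J))%N.
  by apply: leq_trans h1 _; rewrite leq_mul2l DJ orbT.
rewrite mulnA ltn_mul2r J0 /= => h2; apply: leq_trans h2 _.
rewrite [(2 ^ i.+2)%N]expnS mulnA leq_mul2r; apply/orP; right; lia.
Qed.

Lemma block_cut_upper (R : realFieldType) (n J i c : nat) : (J <= c)%N ->
  (block_cut n J i c)%:R <= n%:R / (2 ^ i)%:R :> R.
Proof.
move=> Jc; have x0 : (0 < 2 ^ i)%N by rewrite expn_gt0.
rewrite ler_pdivlMr ?ltr0n // -natrM ler_nat /block_cut.
have := leq_trunc_div (n * J) (2 ^ i * c.+1); set M := (_ %/ _)%N => h.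
rewrite -(@leq_pmul2r c.+1) // -mulnA; apply: leq_trans h _.
by rewrite leq_mul2l; apply/orP; right; apply: leqW.
Qed.

Lemma harmonic_le (R : realFieldType) (a h b : nat) : (0 < a)%N -> (b <= 2 ^ h)%N ->
  \sum_(a <= i < b) i%:R^-1 <= h%:R :> R.
Proof.
move=> a0 bh.
apply: (@le_trans _ _ (\sum_(0 <= i < 2 ^ h | (0 < i)%N) i%:R^-1)).
  have [ab|ba] := leqP a b; last first.
    by rewrite big_geq 1?ltnW //; apply: sumr_ge0 => i _; rewrite invr_ge0.
  have {1}-> : \sum_(a <= i < b) i%:R^-1 = \sum_(a <= i < b | (0 < i)%N) i%:R^-1 :> R.
    rewrite big_nat_cond [RHS]big_nat_cond; apply: eq_bigl => i.
    by rewrite andbT; case: (leqP a i) => //= ai; rewrite (leq_trans a0 ai) andbT.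
  rewrite [leRHS](@big_cat_nat _ _ _ a) ?(leq_trans ab) //=.
  rewrite [X in _ <= _ + X](@big_cat_nat _ _ _ b) //=.
  rewrite addrCA lerDl addr_ge0 //; apply: sumr_ge0 => i _; rewrite invr_ge0 //.
rewrite dyadic_split //.
apply: (@le_trans _ _ (\sum_(0 <= i < h) 1)); last by rewrite big_const_nat iter_addr_0 subn0.
apply: ler_sum => i _.
have x0 : 0 < (2 ^ i)%:R :> R by rewrite ltr0n expn_gt0.
apply: (@le_trans _ _ (\sum_(2 ^ i <= p < 2 ^ i.+1) (2 ^ i)%:R^-1)).
  rewrite big_nat_cond [leRHS]big_nat [X in X <= _](_ : _ = \sum_(2 ^ i <= p < 2 ^ i.+1 | (2 ^ i <= p < 2 ^ i.+1)%N) p%:R^-1); last first.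
    apply: eq_bigl => p; case: (leqP (2 ^ i) p) => //= ip; case: ltnP => //= _.
    by rewrite (leq_trans _ ip) // expn_gt0.
  apply: ler_sum => p /andP[ip _].
  by rewrite lef_pV2 ?posrE ?ler_nat // ltr0n (leq_trans _ ip) // expn_gt0.
rewrite big_const_nat iter_addr_0.
have -> : (2 ^ i.+1 - 2 ^ i = 2 ^ i)%N by rewrite expnS; lia.
by rewrite -[leLHS]mulr_natl divff // gt_eqF.
Qed.

Lemma geometric_le (R : realFieldType) (a b : nat) :
  \sum_(a <= i < b) (2 ^ i)%:R^-1 <= 2 / (2 ^ a)%:R :> R.
Proof.
have [ab|ba] := leqP a b; last first.
  by rewrite big_geq 1?ltnW // divr_ge0.
suff : \sum_(a <= i < b) (2 ^ i)%:R^-1 + 2 / (2 ^ b)%:R <= 2 / (2 ^ a)%:R :> R.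
  have : 0 <= 2 / (2 ^ b)%:R :> R by rewrite divr_ge0.
  lra.
rewrite -(subnK ab); elim: (b - a)%N => [|d IH]; first by rewrite add0n big_geq // add0r.
rewrite addSn big_nat_recr ?leq_addl //=; apply: le_trans IH.
rewrite -addrA lerD2l expnS natrM invfM mulrA divff ?pnatr_eq0 // mul1r.
have : 0 <= (2 ^ (d + a))%:R^-1 :> R by rewrite invr_ge0.
lra.
Qed.

(* The bound of [count_primes_ap] solved for the number of primes. *)
Definition ap_prime_bound (q i : nat) : nat :=
  ((4 * 2 ^ i * up_log 2 q + 4 * q * i) %/ (q * i))%N.

Section RegimeA.
Variables (R : rcfType) (q : nat) (zeta : R[i]) (inv : nat -> nat).
Hypothesis zeta_prim : q.-primitive_root zeta.
Hypothesis invP : forall n, (0 < n)%N -> coprime n q -> (inv n * n = 1 %[mod q])%N.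
Variable f : nat -> R[i].
Hypothesis f_le1 : forall n, (0 < n)%N -> cabs (f n) <= 1.
Variables (n J i0 i1 : nat).
Hypothesis J_gt0 : (0 < J)%N.
Hypothesis i0_gt0 : (0 < i0)%N.
Hypothesis q4 : (4 <= q)%N.
Hypothesis leqn : (q * 2 ^ i1 <= n)%N.

Let K (i : nat) : nat := ap_prime_bound q i.
Let cnt (i c : nat) : nat := (\sum_(0 <= p < 2 ^ i1 | block_prime q J i0 i c p) 1)%N.

(** Here k = 1. Since q is at most the cut, completion costs only a factor 2, and the energy is at
    most [cnt * K]. The natural bound sqrt(2 cnt K) is replaced by cnt / J + K J, which is linear in
    [cnt] and so can be summed over the blocks. *)
Lemma small_modulus_block (i c : nat) : (i0 <= i < i1)%N -> (J <= c < 2 * J)%N ->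
  \sum_(1 <= m < (block_cut n J i c).+1 | coprime m q)
      cabs (\sum_(0 <= p < 2 ^ i1 | block_prime q J i0 i c p) f p * zeta ^+ (inv p * inv m))
  <= n%:R / (2 ^ i)%:R * ((cnt i c)%:R / J%:R + (K i)%:R * J%:R).
Proof.
move=> /andP[ii0 ii1] /andP[Jc cJ].
have ig0 : (0 < i)%N by apply: leq_trans ii0.
have q0 : (0 < q)%N by lia.
have qi0 : (0 < q * i)%N by rewrite muln_gt0 q0.
have K4 : (4 <= K i)%N by rewrite /K /ap_prime_bound leq_divRL //; lia.
have K0 : (0 < K i)%N by lia.
have KR : 0 < (K i)%:R :> R by rewrite ltr0n.
have JR : 0 < J%:R :> R by rewrite ltr0n.
set Y := _ + _.
have Y0 : 0 < Y by rewrite /Y ltr_wpDl ?mulr_gt0 ?divr_ge0.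
apply: (@le_trans _ _ ((block_cut n J i c)%:R * Y)); last first.
  by rewrite ler_pM2r // block_cut_upper.
apply: (@block_bound _ _ _ _ zeta_prim invP _ _ _ _ 1) => //.
  by move=> p /block_prime_dyadic[pp _ _ _]; apply: f_le1; apply: prime_gt0.
have en : (energy q (2 ^ i1) (block_prime q J i0 i c) inv 1 <= cnt i c * K i)%N.
  apply: energy_one_le => // [p /block_prime_dyadic[] //|a _].
  rewrite /K /ap_prime_bound leq_divRL //.
  apply: leq_trans (count_primes_ap a q4 ig0).
  rewrite mulnC leq_mul2l; apply/orP; right.
  by apply: sum1_nat_sub => p _ /andP[/block_prime_dyadic[-> -> -> ->] ->].
have Mq : (q <= block_cut n J i c)%N.
  rewrite /block_cut leq_divRL ?muln_gt0 ?expn_gt0 //.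
  have h1 : (2 ^ i * c.+1 <= 2 ^ i1 * J)%N.
    apply: (@leq_trans (2 ^ i * (2 * J))%N); first by rewrite leq_mul2l cJ orbT.
    by rewrite mulnA -expnSr leq_mul2r leq_exp2l // ii1 orbT.
  apply: (@leq_trans (q * (2 ^ i1 * J))%N); first by rewrite leq_mul2l h1 orbT.
  by rewrite mulnA leq_mul2r leqn orbT.
set M := block_cut n J i c in Mq *.
have h2 : ((M %/ q + 1) * q <= 2 * M)%N.
  by have := leq_trunc_div M q; lia.
apply: (@le_trans _ _ ((2 * M * (cnt i c * K i))%N%:R)).
  by rewrite ler_nat leq_mul.
have -> : (2 * M * (cnt i c * K i))%N%:R = M%:R * (2 * ((cnt i c)%:R * (K i)%:R)) :> R.
  by rewrite !natrM; ring.
rewrite muln1 ler_wpM2l //.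
have : 0 <= ((cnt i c)%:R / J%:R - (K i)%:R * J%:R) ^+ 2 :> R by apply: sqr_ge0.
have e : (cnt i c)%:R * (K i)%:R = (cnt i c)%:R / J%:R * ((K i)%:R * J%:R) :> R.
  by field; rewrite gt_eqF.
have : 0 <= (cnt i c)%:R * (K i)%:R :> R by rewrite mulr_ge0.
rewrite /Y; move: e; set x := _ / _; set y := _ * J%:R; set z := _ * (K i)%:R.
move=> -> ; rewrite !expr2; nra.
Qed.

End RegimeA.

Section RegimeASum.
Variables (R : realFieldType) (n J q i0 i1 h : nat).
Hypothesis J_gt0 : (0 < J)%N.
Hypothesis i0_gt0 : (0 < i0)%N.
Hypothesis q_gt0 : (0 < q)%N.
Hypothesis i1h : (i1 <= 2 ^ h)%N.

Let L : R := recip_sum R (2 ^ i1) (window_prime q i0).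
Let lam := up_log 2 q.
Let K (i : nat) : nat := ap_prime_bound q i.
Let cnt (i c : nat) : nat := (\sum_(0 <= p < 2 ^ i1 | block_prime q J i0 i c p) 1)%N.

Lemma small_modulus_sum :
  \sum_(i0 <= i < i1) \sum_(J <= c < 2 * J)
     n%:R / (2 ^ i)%:R * ((cnt i c)%:R / J%:R + (K i)%:R * J%:R)
  <= n%:R * (2 * L / J%:R + J%:R ^+ 2 * (4 * lam%:R * h%:R / q%:R + 8 / (2 ^ i0)%:R)) :> R.
Proof.
have JR : 0 < J%:R :> R by rewrite ltr0n.
have qR : 0 < q%:R :> R by rewrite ltr0n.
under eq_bigr do under eq_bigr do rewrite mulrDr.
under eq_bigr do rewrite big_split /=.
rewrite big_split /= mulrDr; apply: lerD.
  (* As p < 2^(i+1), a prime counted with weight 1 / 2^i costs at most 2 / p, and the blocks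
     recombine to L. *)
  apply: (@le_trans _ _ (\sum_(i0 <= i < i1) \sum_(J <= c < 2 * J)
     \sum_(0 <= p < 2 ^ i1 | block_prime q J i0 i c p) n%:R / J%:R * (2 / p%:R))).
    apply: ler_sum => i _; apply: ler_sum => c _.
    rewrite -mulr_sumr /cnt natr_sum.
    rewrite [leLHS](_ : _ = n%:R / J%:R * (\sum_(0 <= p < 2 ^ i1 | block_prime q J i0 i c p) 1 / (2 ^ i)%:R)); last first.
      by rewrite -mulr_suml; field; rewrite !gt_eqF // ltr0n expn_gt0.
    rewrite ler_wpM2l ?divr_ge0 //; apply: ler_sum => p /block_prime_dyadic[pp _ _ pi].
    rewrite ler_pdivlMr ?ltr0n ?prime_gt0 // mulrAC ler_pdivrMr ?ltr0n ?expn_gt0 //.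
    by rewrite mul1r -natrM ler_nat -expnS ltnW.
  rewrite -(@sum_blocks q J i0 i1 J_gt0 R (fun _ _ p => n%:R / J%:R * (2 / p%:R))).
  rewrite -!mulr_sumr -/(recip_sum R _ _) -/L le_eqVlt; apply/orP; left; apply/eqP; ring.
under eq_bigr do rewrite big_const_nat iter_addr_0 mul2n -addnn addnK -mulr_natr.
have kb i : (i0 <= i < i1)%N -> (K i)%:R / (2 ^ i)%:R <= 4 * lam%:R / q%:R * i%:R^-1 + 4 * (2 ^ i)%:R^-1 :> R.
  move=> /andP[ii0 _].
  have iR : 0 < i%:R :> R by rewrite ltr0n (leq_trans i0_gt0).
  have xR : 0 < (2 ^ i)%:R :> R by rewrite ltr0n expn_gt0.
  rewrite ler_pdivrMr //; apply: le_trans (natdiv_le _ _ _) _.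
  rewrite natrD !natrM le_eqVlt; apply/orP; left; apply/eqP; field.
  by rewrite !gt_eqF.
apply: (@le_trans _ _ (\sum_(i0 <= i < i1) n%:R * J%:R ^+ 2 * (4 * lam%:R / q%:R * i%:R^-1 + 4 * (2 ^ i)%:R^-1))).
  rewrite [leLHS]big_nat [leRHS]big_nat; apply: ler_sum => i /kb hi.
  rewrite [leLHS](_ : _ = n%:R * J%:R ^+ 2 * ((K i)%:R / (2 ^ i)%:R)); last by ring.
  by rewrite ler_wpM2l // mulr_ge0 // sqr_ge0.
rewrite -mulr_sumr -mulrA ler_wpM2l // ler_wpM2l ?sqr_ge0 //.
rewrite big_split /= -!mulr_sumr; apply: lerD.
  have -> : 4 * lam%:R * h%:R / q%:R = 4 * lam%:R / q%:R * h%:R :> R by rewrite mulrAC.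
  rewrite ler_wpM2l ?divr_ge0 ?mulr_ge0 //.
  exact: harmonic_le.
have := geometric_le R i0 i1; lra.
Qed.

End RegimeASum.

(** It suffices that q <= M 2^(e-1), with e the exponent of the conclusion. In the 2E-th power,
    q^(E+2) is absorbed by (n+1)^(2E) and only q^(E-2) remains. Since q is about 2^(2ki), this saves
    about 4ki in the exponent. *)
Lemma large_modulus_exponent (E h i l k q n M : nat) :
  (2 <= E)%N -> ((10 * h + 6) * E <= i)%N -> (4 * E * i.+1 <= l)%N ->
  k = (l %/ (2 * i.+1))%N -> (q < 2 ^ l.+1)%N -> (0 < q)%N ->
  (q ^ (E + 2) <= n.+1 ^ (2 * E))%N -> (n < M * 2 ^ i.+2)%N ->
  (M + q <= M * 2 ^ (k * (i - (5 * h + 2))))%N.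
Proof.
move=> E2 iE lE ek ql q0 qn nM.
have i2 : ((10 * h + 6) * 2 <= i)%N by apply: leq_trans iE; rewrite leq_mul2l E2 orbT.
have k2E : (2 * E <= k)%N.
  rewrite ek leq_divRL //; apply: leq_trans lE; lia.
have lk : (l.+1 <= 2 * k.+1 * i.+1)%N.
  have := @ltn_ceil l (2 * i.+1) isT; rewrite -ek; lia.
set e := (k * _)%N.
(* The surplus 4ki is spent twice: i >= (10h+6) E pays for the loss of 5h+2 per prime, and k >= 2E
   pays for rounding k and for the factor 2^(i+2) between M and n. *)
have key : (2 * k.+1 * i.+1 * (E - 2) + i.+2 * (2 * E) + 2 * E <= e * (2 * E))%N.
  rewrite /e.
  have [j ej] : exists j, i = (j + (5 * h + 2))%N by exists (i - (5 * h + 2))%N; lia.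
  have -> : (i - (5 * h + 2) = j)%N by lia.
  have [E' eE] : exists E', E = (E' + 2)%N by exists (E - 2)%N; lia.
  have -> : (E - 2 = E')%N by lia.
  have h1 : (2 * k * (5 * h + 3) * E <= k * i)%N.
    have : (2 * (5 * h + 3) * E <= i)%N by lia.
    move=> hh; have : (k * (2 * (5 * h + 3) * E) <= k * i)%N by rewrite leq_mul2l hh orbT.
    lia.
  have h2 : (2 * E * i <= k * i)%N by rewrite leq_mul2r k2E orbT.
  have i4 : (4 <= i)%N by lia.
  have h3 : (4 * E <= E * i)%N by rewrite mulnC leq_mul2l i4 orbT.
  have h4 : (E' * k <= E * k)%N by rewrite leq_mul2r; lia.
  have h5 : (E' * i <= E * i)%N by rewrite leq_mul2r; lia.
  have h6 : (k * j * (2 * E) + k * (5 * h + 2) * (2 * E) = k * i * (2 * E))%N by rewrite ej; ring.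
  have h7 : (k * i * E = k * i * E' + 2 * (k * i))%N by rewrite eE; ring.
  have h8 : (2 * k * (5 * h + 3) * E = 2 * k * (5 * h + 2) * E + 2 * (k * E))%N by ring.
  suff : (2 * k.+1 * i.+1 * E' + i.+2 * (2 * E) + 2 * E + k * (5 * h + 2) * (2 * E) <= k * i * (2 * E))%N.
    by rewrite -h6; lia.
  have -> : (2 * k.+1 * i.+1 * E' + i.+2 * (2 * E) + 2 * E + k * (5 * h + 2) * (2 * E)
    = 2 * (k * i * E') + 2 * (E' * k) + 2 * (E' * i) + 2 * E' + 2 * (E * i) + 6 * E
      + 2 * k * (5 * h + 2) * E)%N by ring.
  have -> : (k * i * (2 * E) = 2 * (k * i * E') + 4 * (k * i))%N by rewrite mulnCA; lia.
  lia.
have e1 : (0 < e)%N by rewrite muln_gt0; apply/andP; split; lia.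
have M0 : (0 < M)%N by case: M nM => //; rewrite mul0n.
suff h1 : (q <= M * 2 ^ e.-1)%N.
  have -> : (2 ^ e = 2 ^ e.-1 + 2 ^ e.-1)%N by rewrite -{1}(prednK e1) expnS; lia.
  by rewrite mulnDr leq_add // leq_pmulr // expn_gt0.
rewrite -(@leq_pmul2r (2 ^ i.+2)) ?expn_gt0 //.
rewrite mulnAC; apply: (@leq_trans (n.+1 * 2 ^ e.-1)%N); last by rewrite leq_mul2r nM orbT.
have E0 : (0 < 2 * E)%N by lia.
have [B eB] : exists B, B = (2 ^ i.+2)%N by exists (2 ^ i.+2)%N.
have [G eG] : exists G, G = (2 ^ e.-1)%N by exists (2 ^ e.-1)%N.
rewrite -(leq_exp2r _ _ E0) -eB -eG !expnMn.
have -> : (q ^ (2 * E) = q ^ (E + 2) * q ^ (E - 2))%N by rewrite -expnD; congr (_ ^ _)%N; lia.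
rewrite -mulnA; apply: leq_mul => //.
apply: (@leq_trans ((2 ^ (2 * k.+1 * i.+1)) ^ (E - 2) * B ^ (2 * E))%N).
  rewrite leq_mul2r; apply/orP; right.
  case: (posnP (E - 2)) => [->//|E20].
  rewrite leq_exp2r // ltnW // (leq_trans ql) // leq_exp2l //.
rewrite eB eG -!expnM -expnD leq_exp2l //.
have : (e * (2 * E) = e.-1 * (2 * E) + 2 * E)%N by rewrite -{1}(prednK e1) mulSn addnC.
lia.
Qed.

Section RegimeB.
Variables (R : rcfType) (q : nat) (zeta : R[i]) (inv : nat -> nat).
Hypothesis zeta_prim : q.-primitive_root zeta.
Hypothesis invP : forall n, (0 < n)%N -> coprime n q -> (inv n * n = 1 %[mod q])%N.
Variable f : nat -> R[i].
Hypothesis f_le1 : forall n, (0 < n)%N -> cabs (f n) <= 1.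
Variables (n J E h i0 i1 : nat).
Hypothesis J_gt0 : (0 < J)%N.
Hypothesis E2 : (2 <= E)%N.
Hypothesis i0E : ((10 * h + 6) * E <= i0)%N.
Hypothesis leXn : (2 ^ i1 <= n)%N.
Hypothesis qE : (q ^ (E + 2) <= n.+1 ^ (2 * E))%N.
Hypothesis ql : (4 * E * i1 <= trunc_log 2 q)%N.
Hypothesis qu : (trunc_log 2 q <= 2 ^ (h + 2))%N.

(* k is maximal with (2^(i+1))^(2k) <= q, which makes [energy_le] applicable;
   the size of q relative to n then leaves room for the gain 2^(2h). *)
Lemma large_modulus_block (i c : nat) : (i0 <= i < i1)%N -> (J <= c < 2 * J)%N ->
  \sum_(1 <= m < (block_cut n J i c).+1 | coprime m q)
      cabs (\sum_(0 <= p < 2 ^ i1 | block_prime q J i0 i c p) f p * zeta ^+ (inv p * inv m))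
  <= n%:R / (2 ^ (2 * h))%:R.
Proof.
move=> /andP[ii0 ii1] /andP[Jc cJ].
have q0 : (0 < q)%N := prim_order_gt0 zeta_prim.
have [M0 nM] := @block_cut_lower n J i c i1 J_gt0 ii1 cJ leXn.
pose l := trunc_log 2 q.
have /andP[lq ql1] : (2 ^ l <= q < 2 ^ l.+1)%N by apply: trunc_log_bounds.
pose k := (l %/ (2 * i.+1))%N.
have iE : ((10 * h + 6) * E <= i)%N by apply: leq_trans ii0.
have i2 : ((10 * h + 6) * 2 <= i)%N by apply: leq_trans iE; rewrite leq_mul2l E2 orbT.
have lE : (4 * E * i.+1 <= l)%N by apply: leq_trans ql; rewrite leq_mul2l ii1 orbT.
have k0 : (0 < k)%N by rewrite /k divn_gt0 //; apply: leq_trans lE; rewrite leq_mul2r orFb; lia.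
have ex := large_modulus_exponent E2 iE lE (erefl k) ql1 q0 qE nM.
have h2i : (h + 2 <= i)%N by lia.
have kl : (k * (2 * i.+1) <= l)%N by apply: leq_trunc_div.
have k2l : (2 * k <= l)%N.
  by apply: leq_trans kl; rewrite mulnCA leq_mul2l leq_pmulr.
have kh : (k <= 2 ^ (h + 2))%N by apply: leq_trans qu; lia.
have k2i : (k < 2 ^ i)%N.
  have : (2 ^ (h + 2) <= 2 ^ i)%N by rewrite leq_exp2l.
  have : (2 * k <= 2 ^ (h + 2))%N by apply: leq_trans qu.
  lia.
set M := block_cut n J i c in M0 nM ex *.
pose Y : R := (2 ^ i)%:R / (2 ^ (2 * h))%:R.
have iR : 0 < (2 ^ i)%:R :> R by rewrite ltr0n expn_gt0.
have hR : 0 < (2 ^ (2 * h))%:R :> R by rewrite ltr0n expn_gt0.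
apply: (@le_trans _ _ (M%:R * Y)); last first.
  rewrite /Y mulrA ler_pM2r ?invr_gt0 // -ler_pdivlMr //; exact: block_cut_upper.
apply: (@block_bound _ _ _ _ zeta_prim invP _ _ _ _ k) => //.
- by move=> p /block_prime_dyadic[pp _ _ _]; apply: f_le1; apply: prime_gt0.
- by rewrite divr_gt0.
have en : (energy q (2 ^ i1) (block_prime q J i0 i c) inv k <= (2 ^ i) ^ k * (2 ^ (h + 2)) ^ k)%N.
  apply: leq_trans (@energy_le q inv invP _ _ k (2 ^ i.+1) _ _) _.
  - by move=> p /block_prime_dyadic[-> -> kp pi]; split => //; [exact: leq_trans k2i kp|exact: ltnW].
  - apply: (@leq_trans (2 ^ i.+1 * (2 ^ i.+1) ^ (2 * k).-1)%N).
      rewrite ltn_mul2r expn_gt0 expn_gt0 /=; apply: ltn_trans k2i _.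
      by rewrite ltn_exp2l.
    rewrite -expnS prednK ?muln_gt0 // -expnM; apply: leq_trans lq.
    have -> : (i.+1 * (2 * k) = k * (2 * i.+1))%N by ring.
    by rewrite leq_exp2l.
  by apply: leq_mul; rewrite leq_exp2r // block_prime_size.
have h2 : ((M %/ q + 1) * q <= M + q)%N.
  by have := leq_trunc_div M q; lia.
(* The exponents match exactly: 5h+2 is h+2, from k^k <= 2^((h+2)k), plus 4h, from the gain 2^(2h)
   raised to the power 2k. *)
have F : (((M %/ q + 1) * q * energy q (2 ^ i1) (block_prime q J i0 i c) inv k) * (2 ^ (2 * h)) ^ (2 * k)
   <= M * (2 ^ i) ^ (2 * k))%N.
  apply: (@leq_trans ((M * 2 ^ (k * (i - (5 * h + 2)))) * ((2 ^ i) ^ k * (2 ^ (h + 2)) ^ k) * (2 ^ (2 * h)) ^ (2 * k))%N).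
    rewrite leq_mul2r; apply/orP; right; apply: leq_mul => //.
    exact: leq_trans h2 ex.
  rewrite -!mulnA leq_mul2l; apply/orP; right.
  rewrite -!expnM -!expnD leq_exp2l //.
  have [j ej] : exists j, i = (j + (5 * h + 2))%N by exists (i - (5 * h + 2))%N; lia.
  have -> : (i - (5 * h + 2) = j)%N by lia.
  rewrite ej; lia.
rewrite /Y expr_div_n mulrA ler_pdivlMr ?exprn_gt0 //.
by rewrite -!natrX -!natrM ler_nat.
Qed.

End RegimeB.

(** The gain 2^(2h) is spent on the number of blocks, at most 2^h values of i times 2^h values of
    c. *)
Lemma large_modulus_sum (R : realFieldType) (n J h i0 i1 : nat) : (J <= 2 ^ h)%N -> (i1 <= 2 ^ h)%N ->
  \sum_(i0 <= i < i1) \sum_(J <= c < 2 * J) n%:R / (2 ^ (2 * h))%:R <= n%:R :> R.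
Proof.
move=> Jh ih; rewrite !big_const_nat !iter_addr_0.
rewrite -mulrnA -[leLHS]mulr_natr -mulrA ler_piMr //.
rewrite mulrC ler_pdivrMr ?ltr0n ?expn_gt0 // mul1r ler_nat.
rewrite [(2 * h)%N]mul2n -addnn expnD.
by apply: leq_mul; lia.
Qed.

(** * The reciprocal sum over the window and the choice of parameters *)

Lemma dyadic_cat (V : nmodType) (P : pred nat) (F : nat -> V) (i0 i1 : nat) :
  (i0 <= i1)%N ->
  \sum_(2 ^ i0 <= p < 2 ^ i1 | P p) F p =
  \sum_(i0 <= i < i1) \sum_(2 ^ i <= p < 2 ^ i.+1 | P p) F p.
Proof.
move=> ii; rewrite -(subnK ii); elim: (i1 - i0)%N => [|d IH].
  by rewrite add0n !big_geq.
by rewrite addSn big_nat_recr ?leq_addl //= -IH -big_cat_nat // leq_exp2l // leq_addl.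
Qed.

(** At most log q <= 2^i0 primes divide q, and those in the window are at least 2^i0, so excluding
    them costs at most 1. *)
Lemma recip_sum_ge (R : realFieldType) (q i0 i1 t : nat) : (0 < q)%N -> (0 < i0)%N ->
  (128 ^ t * i0 <= i1)%N -> (trunc_log 2 q <= 2 ^ i0)%N ->
  t%:R / 4 - 1 <= recip_sum R (2 ^ i1) (window_prime q i0).
Proof.
move=> q0 i00 ti qi.
have iR : 0 < (2 ^ i0)%:R :> R by rewrite ltr0n expn_gt0.
have S1 : t%:R / 4 <= \sum_(0 <= p < 2 ^ i1 | (2 ^ i0 <= p)%N && prime p) p%:R^-1 :> R.
  apply: le_trans (prime_sum_groups R t i00) _.
  have ti0 : (i0 <= 128 ^ t * i0)%N by rewrite leq_pmull // expn_gt0.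
  apply: (@le_trans _ _ (\sum_(i0 <= i < i1) dyadic_prime_sum R i)).
    rewrite [leRHS](@big_cat_nat _ _ _ (128 ^ t * i0)) //= lerDl.
    by apply: sumr_ge0 => i _; apply: dyadic_prime_sum_ge0.
  have ii : (i0 <= i1)%N by apply: leq_trans ti.
  rewrite [leRHS](@big_cat_nat _ _ _ (2 ^ i0)) //=; last by rewrite leq_exp2l.
  rewrite [X in _ <= X + _]big_nat_cond [X in _ <= X + _]big_pred0 ?add0r; last first.
    by move=> p; case: (leqP (2 ^ i0) p); rewrite ?andbF.
  have -> : \sum_(2 ^ i0 <= p < 2 ^ i1 | (2 ^ i0 <= p)%N && prime p) p%:R^-1 =
     \sum_(2 ^ i0 <= p < 2 ^ i1 | prime p) p%:R^-1 :> R.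
    rewrite big_nat_cond [RHS]big_nat_cond; apply: eq_bigl => p.
    by case: (leqP (2 ^ i0) p).
  by rewrite (dyadic_cat _ _ ii).
have S2 : \sum_(0 <= p < 2 ^ i1 | [&& (2 ^ i0 <= p)%N, prime p & ~~ coprime p q]) p%:R^-1 <= 1 :> R.
  pose s := [seq p <- index_iota 0 (2 ^ i1) | [&& (2 ^ i0 <= p)%N, prime p & ~~ coprime p q]].
  have sP p : p \in s -> prime p /\ (p %| q)%N.
    by rewrite mem_filter => /andP[/and3P[_ pp]]; rewrite prime_coprime // negbK.
  have sz : (size s <= trunc_log 2 q)%N.
    apply: trunc_log_max => //; apply: (@leq_trans (\prod_(p <- s) p)); last first.
      apply: dvdn_leq => //; apply: dvdn_prod_primes => //.
      by rewrite filter_uniq // iota_uniq.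
    elim: (s) sP => [|p r IH] H; first by rewrite big_nil.
    rewrite big_cons /= expnS leq_mul //.
      by have [pp _] := H p (mem_head _ _); apply: prime_gt1.
    by apply: IH => x xr; apply: H; rewrite inE xr orbT.
  apply: (@le_trans _ _ (\sum_(0 <= p < 2 ^ i1 | [&& (2 ^ i0 <= p)%N, prime p & ~~ coprime p q]) (2 ^ i0)%:R^-1)).
    apply: ler_sum => p /and3P[ip pp _].
    by rewrite lef_pV2 ?posrE ?ler_nat // ltr0n prime_gt0.
  rewrite big_const_seq iter_addr_0 -size_filter -/s -[leLHS]mulr_natl ler_pdivrMr // mul1r ler_nat.
  exact: leq_trans sz qi.
have : \sum_(0 <= p < 2 ^ i1 | (2 ^ i0 <= p)%N && prime p) p%:R^-1 =
  recip_sum R (2 ^ i1) (window_prime q i0) +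
  \sum_(0 <= p < 2 ^ i1 | [&& (2 ^ i0 <= p)%N, prime p & ~~ coprime p q]) p%:R^-1 :> R.
  rewrite (bigID (fun p => coprime p q)) /=; congr (_ + _); apply: eq_bigl => p.
    by rewrite /window_prime andbA.
  by rewrite -andbA.
lra.
Qed.

Lemma linear_le_exp2_half (K h : nat) : (16 * K <= h)%N -> (K * h.+1 <= 2 ^ (h %/ 2))%N.
Proof.
move=> hK; set v := (h %/ 2 %/ 2)%N.
have vK : (4 * K <= v)%N by rewrite /v; lia.
have hv : (h.+1 <= 4 * v.+1)%N by rewrite /v; lia.
have v2 : (2 * v <= h %/ 2)%N by rewrite /v; lia.
apply: (@leq_trans (2 ^ (2 * v))%N); last by rewrite leq_exp2l.
have -> : (2 ^ (2 * v) = 2 ^ v * 2 ^ v)%N by rewrite mul2n -addnn expnD.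
have vl : (v < 2 ^ v)%N by apply: ltn_expl.
have e4 : (4 * K * v.+1 = K * (4 * v.+1))%N by ring.
apply: (@leq_trans (4 * K * v.+1)%N); first by rewrite e4 leq_mul2l hv orbT.
by apply: leq_mul => //; apply: leq_trans vK (ltnW vl).
Qed.

(* Here h and J stand for loglog n and its square root, up to constants, and
   2^i0 and 2^i1 are a power of log n and a small power of n. *)
Lemma inverse_twisted_sum_le (R : rcfType) (E : nat) : (2 <= E)%N ->
  exists h0 : nat, forall (h n J q : nat) (zeta : R[i]) (inv : nat -> nat) (f : nat -> R[i]),
  (h0 <= h)%N -> (2 ^ (2 ^ h) <= n)%N -> (n < 2 ^ (2 ^ h.+1))%N ->
  (0 < J)%N -> (J ^ 2 <= h)%N -> (4 <= q)%N ->
  (J ^ 3 * up_log 2 q <= 32 * q)%N -> (q ^ (E + 2) <= n.+1 ^ (2 * E))%N ->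
  q.-primitive_root zeta ->
  (forall n, (0 < n)%N -> coprime n q -> (inv n * n = 1 %[mod q])%N) ->
  (forall m n, (0 < m)%N -> (0 < n)%N -> coprime m n -> f (m * n)%N = f m * f n) ->
  (forall n, (0 < n)%N -> cabs (f n) <= 1) ->
  cabs (\sum_(1 <= m < n.+1 | coprime m q) f m * zeta ^+ inv m) <= (200 * 200) * (n%:R / J%:R).
Proof.
(* 2^b > b = 4E + 2 makes 2^h exceed 4 E i1 + 2 i1: one i1 is lost in q > n / 2^i1, the other covers
   rounding. [K] is such that i0 2^b <= K (h + 1). *)
move=> E2; pose b := (4 * E + 2)%N; pose K := (10 * E * 2 ^ b)%N.
have K1 : (b < K)%N.
  have := @ltn_expl 2 b isT; rewrite /K; have : (1 <= 10 * E)%N by lia.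
  by move=> h1 h2; apply: leq_trans h2 _; rewrite leq_pmull.
exists (100 + 16 * K)%N => h n J q zeta inv f hh0 nl nu J0 Jh q4 qJ qE prim invP fM f_le1.
have q0 : (0 < q)%N by lia.
have h100 : (100 <= h)%N by lia.
have hK : (16 * K <= h)%N by lia.
have bh : (b <= h)%N by lia.
pose i0 := ((10 * h + 6) * E)%N; pose i1 := (2 ^ (h - b))%N.
have i1b : (2 ^ h = i1 * 2 ^ b)%N by rewrite /i1 -expnD subnK.
have i1h : (i1 <= 2 ^ h)%N by rewrite leq_exp2l // leq_subr.
have i1g : (0 < i1)%N by rewrite expn_gt0.
have i0h : (20 * h + 12 <= i0)%N.
  by apply: (@leq_trans ((10 * h + 6) * 2)%N); [lia|rewrite leq_mul2l E2 orbT].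
have i0g : (0 < i0)%N by lia.
pose t := (h %/ 14)%N.
have ti : (128 ^ t * i0 <= i1)%N.
  have i0K : (i0 * 2 ^ b <= K * h.+1)%N.
    have -> : (K * h.+1 = 10 * h.+1 * E * 2 ^ b)%N by rewrite /K; ring.
    by rewrite !leq_mul2r; lia.
  rewrite -(@leq_pmul2r (2 ^ b)) ?expn_gt0 // -i1b -mulnA.
  apply: (@leq_trans (2 ^ (h %/ 2) * 2 ^ (h %/ 2))%N).
    apply: leq_mul; last by apply: leq_trans i0K (linear_le_exp2_half hK).
    by rewrite -[128%N]/(2 ^ 7)%N -expnM leq_exp2l // /t; lia.
  by rewrite -expnD leq_exp2l //; lia.
(* Above, t = h / 14 spends half of the exponent h on 128^t = 2^(7t) and leaves the other half for
   i0 2^b. *)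
have Xn : (2 ^ i1 <= n)%N by apply: leq_trans nl; rewrite leq_exp2l.
have qu : (trunc_log 2 q <= 2 ^ (h + 2))%N.
  have q2 : (q <= n.+1 ^ 2)%N.
    have E0 : (0 < E)%N by lia.
    rewrite -(leq_exp2r _ _ E0) -expnM; apply: leq_trans qE.
    by rewrite leq_pexp2l // leq_addr.
  have q3 : (q <= 2 ^ 2 ^ (h + 2))%N.
    apply: leq_trans q2 _; apply: (@leq_trans ((2 ^ 2 ^ h.+1) ^ 2)%N).
      by rewrite leq_exp2r.
    by rewrite -expnM -expnSr addn2.
  by have := leq_trunc_log 2 q3; rewrite trunc_expnK.
have qi0 : (trunc_log 2 q <= 2 ^ i0)%N.
  apply: leq_trans qu _; rewrite leq_exp2l //.
  by move: (i0) i0h => j hj; clear -hj; lia.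
have Lge : h%:R / 200 <= recip_sum R (2 ^ i1) (window_prime q i0).
  have rs := recip_sum_ge R q0 i0g ti qi0.
  apply: le_trans rs.
  have : (h <= 14 * t + 13)%N by rewrite /t; lia.
  rewrite -(ler_nat R) natrD natrM; have : (100 : R) <= h%:R by rewrite (ler_nat R 100).
  lra.
have hR : (100 : R) <= h%:R by rewrite (ler_nat R 100).
have L0 : 0 < recip_sum R (2 ^ i1) (window_prime q i0) by lra.
have JR1 : (1 : R) <= J%:R by rewrite ler1n.
have JR0 : (0 : R) < J%:R by rewrite ltr0n.
have JhR : J%:R ^+ 2 <= h%:R :> R by rewrite -natrX ler_nat.
have hlt : (h < 2 ^ h)%N by apply: ltn_expl.
have JJ : (J <= J ^ 2)%N by rewrite -{1}[J]expn1 leq_pexp2l.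
have Jlh : (J <= h)%N by apply: leq_trans Jh.
have red := bilinear_reduction prim invP fM f_le1 J0 Xn L0.
set S := cabs _ in red *; set L := recip_sum _ _ _ in Lge L0 red *.
have nR : 0 <= n%:R :> R by [].
have X1 : (2 ^ i1)%N%:R <= n%:R :> R by rewrite ler_nat.
have lam3 : J%:R ^+ 3 * (up_log 2 q)%:R <= 32 * q%:R :> R.
  by rewrite -natrX -!natrM ler_nat.
have qR : 0 < q%:R :> R by rewrite ltr0n.
have i0R : 8 * h%:R <= (2 ^ i0)%:R :> R.
  rewrite -natrM ler_nat; apply: (@leq_trans (2 ^ 3 * 2 ^ h)%N); first by rewrite leq_mul // ltnW.
  rewrite -expnD leq_exp2l //; move: (i0) i0h => j hj; clear -hj; lia.
have x0 : 0 < (2 ^ i0)%:R :> R by rewrite ltr0n expn_gt0.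
have block : L * S <= n%:R * (2 * J%:R + L / J%:R) + 2 * n%:R * L / (2 ^ i0)%:R
    + (n%:R * L / J%:R + (2 ^ i1)%N%:R) + n%:R * (2 * L / J%:R + 128 * h%:R / J%:R + 1).
  (* In the first case every cut is at least q; in the second, log q is at least 4 E i1, which makes
     k >= 2E on every block. *)
  have [qn|nq] := leqP (q * 2 ^ i1) n.
    have hA := small_modulus_block prim invP f_le1 J0 i0g q4 qn.
    apply: le_trans (red _ hA) _.
    rewrite lerD2l; apply: le_trans (small_modulus_sum R n J0 i0g q0 i1h) _.
    rewrite ler_wpM2l // -/L -addrA lerD2l mulrDr; apply: lerD.
      rewrite ler_pdivlMr // [leLHS](_ : _ = 4 * h%:R * (J%:R ^+ 3 * (up_log 2 q)%:R) / q%:R); last by ring.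
      rewrite ler_pdivrMr //.
      have : 0 <= 4 * h%:R :> R by rewrite mulr_ge0.
      nra.
    rewrite mulrA ler_pdivrMr // mul1r; lra.
  have ql : (4 * E * i1 <= trunc_log 2 q)%N.
    have /andP[_ ql1] := @trunc_log_bounds 2 q isT q0.
    have : (2 ^ 2 ^ h < 2 ^ ((trunc_log 2 q).+1 + i1))%N.
      apply: leq_ltn_trans nl _; apply: ltn_trans nq _.
      by rewrite expnD ltn_mul2r expn_gt0.
    rewrite ltn_exp2l // i1b.
    have : (i1 * b <= i1 * 2 ^ b)%N by rewrite leq_mul2l ltnW ?orbT // ltn_expl.
    have -> : (i1 * b = 4 * E * i1 + 2 * i1)%N by rewrite /b; ring.
    move: (i1 * 2 ^ b)%N (4 * E * i1)%N i1g => x y; move: (i1) (trunc_log 2 q) => z l.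
    clear; lia.
  have hB := large_modulus_block prim invP f_le1 J0 E2 (leqnn _) Xn qE ql qu.
  apply: le_trans (red _ hB) _.
  rewrite lerD2l; apply: le_trans (large_modulus_sum R n i0 _ i1h) _.
    exact: leq_trans Jlh (ltnW hlt).
  rewrite ler_peMr // lerDr addr_ge0 // divr_ge0 ?mulr_ge0 // ltW //.
have {}block : L * S <= n%:R * (L * ((200 * 200) / J%:R)).
  apply: le_trans block _.
  have y1 : J%:R <= h%:R / J%:R :> R by rewrite ler_pdivlMr // -expr2.
  have y2 : 1 <= h%:R / J%:R :> R by apply: le_trans y1.
  have y3 : h%:R / J%:R <= 200 * (L / J%:R).
    by rewrite mulrA ler_pM2r ?invr_gt0 //; lra.
  have y4 : L / (2 ^ i0)%:R <= L / J%:R.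
    rewrite ler_pM2l // lef_pV2 ?posrE //.
    by apply: le_trans i0R; have : J%:R <= h%:R :> R by [rewrite ler_nat]; lra.
  have y5 : 2 * n%:R * L / (2 ^ i0)%:R <= n%:R * (2 * (L / J%:R)).
    rewrite [leLHS](_ : _ = n%:R * (2 * (L / (2 ^ i0)%:R))); last by ring.
    by rewrite ler_wpM2l // ler_wpM2l.
  have y6 : (2 ^ i1)%N%:R <= n%:R * (h%:R / J%:R) :> R.
    by apply: le_trans X1 _; rewrite ler_peMr.
  rewrite -[n%:R * L / _]mulrA.
  have -> : L * ((200 * 200) / J%:R) = (200 * 200) * (L / J%:R) by ring.
  have -> : 2 * L / J%:R = 2 * (L / J%:R) by rewrite mulrA.
  have -> : 128 * h%:R / J%:R = 128 * (h%:R / J%:R) :> R by rewrite mulrA.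
  move: y1 y2 y3 y5 y6; set u := h%:R / J%:R; set w := L / J%:R => y1 y2 y3 y5 y6.
  set v := 2 * w + 128 * u + 1.
  (* J and 1 are at most u, so the left side is at most 6 w + 132 u, and u <= 200 w. *)
  have le : 2 * J%:R + w + 2 * w + (w + u) + v <= 200 * 200 * w by rewrite /v; lra.
  apply: (@le_trans _ _ (n%:R * (2 * J%:R + w + 2 * w + (w + u) + v))).
    rewrite (mulrDr _ _ v) (mulrDr _ _ (w + u)) (mulrDr _ _ (2 * w)) (mulrDr _ w u).
    by rewrite !lerD2r lerD // lerD2l.
  by rewrite ler_wpM2l.
rewrite -(ler_pM2l L0); apply: le_trans block _.
rewrite le_eqVlt; apply/orP; left; apply/eqP; ring.
Qed.

(** * Additive characters and logarithms *)

Section RootsOfUnity.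
Variable R : realType.

Lemma expi2piD (x y : R) : expi2pi (x + y) = expi2pi x * expi2pi y.
Proof.
by apply/eqP; rewrite eq_complex /= mulrDr cosD sinD eqxx /= addrC eqxx.
Qed.

Lemma expi2pi0 : expi2pi (0 : R) = 1.
Proof. by rewrite /expi2pi mulr0 cos0 sin0. Qed.

Lemma expi2pi_nat (n : nat) : expi2pi (n%:R : R) = 1.
Proof.
elim: n => [|n IH]; first exact: expi2pi0.
rewrite -natr1 expi2piD IH mul1r /expi2pi mulr1 mulr_natl cos2pi.
by rewrite sin_mulr2n sinpi mulr0 mul0rn.
Qed.

Lemma expi2pi_int (z : int) : expi2pi (z%:~R : R) = 1.
Proof.
case: z => n; first by rewrite -pmulrn expi2pi_nat.
have := expi2piD ((Negz n)%:~R) (n.+1%:R : R).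
by rewrite expi2pi_nat NegzE mulrNz -pmulrn addNr expi2pi0 mulr1.
Qed.

Lemma expi2piX (x : R) (k : nat) : expi2pi x ^+ k = expi2pi (k%:R * x).
Proof.
elim: k => [|k IH]; first by rewrite mul0r expi2pi0.
by rewrite exprSr IH -expi2piD -natr1 mulrDl mul1r.
Qed.

(** cos(2 pi x) = 1 - 2 sin(pi x)^2, and sin(pi x) > 0. *)
Lemma expi2pi_neq1 (x : R) : 0 < x < 1 -> expi2pi x != 1.
Proof.
move=> /andP[x0 x1]; rewrite eq_complex negb_and; apply/orP; left => /=.
have s0 : 0 < sin (pi * x).
  apply: sin_gt0_pi; rewrite mulr_gt0 ?pi_gt0 //=.
  by rewrite gtr_pMr // pi_gt0.
have -> : 2 * pi * x = (pi * x) *+ 2 by rewrite mulr_natl mulrnAl.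
rewrite cos_mulr2n.
have := cos2Dsin2 (pi * x).
have : 0 < sin (pi * x) ^+ 2 by rewrite exprn_gt0.
move=> h1 h2; rewrite lt_eqF //; lra.
Qed.

Lemma expi2pi_prim (q : nat) (a : int) : (0 < q)%N -> coprimez a q%:Z ->
  q.-primitive_root (expi2pi (a%:~R / q%:R : R)).
Proof.
move=> q0 co; set z := expi2pi _.
have qR : (q%:R : R) != 0 by rewrite pnatr_eq0; case: (q) q0.
have zq : z ^+ q = 1.
  by rewrite expi2piX mulrC divfK // expi2pi_int.
have [m zm mq] := prim_order_exists q0 zq.
have := prim_expr_order zm; rewrite expi2piX => zm1.
suff qm : (q %| m)%N by rewrite (_ : q = m) //; apply/eqP; rewrite eqn_dvd qm.
suff : (q%:Z %| a * m%:Z)%Z by rewrite Gauss_dvdzr // coprimez_sym.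
have [/dvdz_mod0P //|r0] := eqVneq (a * m%:Z %% q%:Z)%Z 0; exfalso.
  have := divz_eq (a * m%:Z) q%:Z.
  set k := (_ %/ _)%Z; set r := (_ %% _)%Z in r0 * => e.
  have q0' : q%:Z != 0 by case: (q) q0.
  have rge : 0 <= r by apply: modz_ge0.
  have rlt : r < q%:Z by rewrite ltz_mod.
  have e2 : m%:R * (a%:~R / q%:R) = k%:~R + r%:~R / q%:R :> R.
    rewrite mulrA; apply: (mulIf qR); rewrite divfK // mulrDl divfK //.
    by rewrite mulrC (pmulrn _ m) -intrM e intrD intrM -pmulrn.
  move: zm1; rewrite e2 expi2piD expi2pi_int mul1r; apply/eqP.
  have rgt : 0 < r by rewrite lt_def r0.
  apply: expi2pi_neq1; apply/andP; split; first by rewrite divr_gt0 ?ltr0z ?ltr0n.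
  by rewrite ltr_pdivrMr ?ltr0n // mul1r (pmulrn _ q) ltr_int.
Qed.

End RootsOfUnity.

Lemma up_log4_le (q : nat) : (2 <= q)%N -> (up_log 2 q ^ 4 <= 256 * q)%N.
Proof.
move=> q2; set l := up_log 2 q.
have l1 : (0 < l)%N by rewrite up_log_gt0.
have h1 : (2 ^ l.-1 < q)%N by apply: up_log_gtn.
have h2 : (2 ^ l <= 2 * q)%N by rewrite -(prednK l1) expnS leq_mul2l ltnW.
suff : (l ^ 4 <= 128 * 2 ^ l)%N by move=> h; apply: leq_trans h _; lia.
(* The induction starts at 6 because (7/6)^4 < 2 < (6/5)^4. *)
have [l5|] := leqP 6 l; last by case: (l) => [|[|[|[|[|[|]]]]]].
rewrite -(subnK l5); elim: (l - 6)%N => [//|k IH].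
rewrite addSn [(2 ^ _.+1)%N]expnS mulnCA.
apply: (@leq_trans (2 * (k + 6) ^ 4)%N); last by rewrite leq_mul2l IH.
rewrite -addnS !expnS !expn0; nia.
Qed.

Lemma nat_sqrt_ex (h : nat) : exists J : nat, (J ^ 2 <= h < J.+1 ^ 2)%N.
Proof.
elim: h => [|h [J /andP[h1 h2]]]; first by exists 0%N.
have [e|ne] := eqVneq h.+1 (J.+1 ^ 2)%N.
  by exists J.+1; rewrite e leqnn /= ltn_exp2r.
by exists J; rewrite (leq_trans h1) //= ltn_neqAle ne.
Qed.

Section Logs.
Variable R : realType.

Lemma ln2_ge : 1 / 2 <= ln 2 :> R.
Proof.
have := @le_ln1Dx R (- (1 / 2)); have -> : -1 < - (1 / 2) :> R by lra.
move=> /(_ isT); have -> : 1 + - (1 / 2) = 2^-1 :> R by lra.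
rewrite lnV ?posrE //; lra.
Qed.

Lemma ln2_le1 : ln 2 <= 1 :> R.
Proof. by have := @le_ln1Dx R 1; have -> : 1 + 1 = 2 :> R by []; apply; lra. Qed.

Lemma lnln_bounds (h n : nat) (N : R) : (8 <= h)%N ->
  (2 ^ (2 ^ h) <= n)%N -> (n < 2 ^ (2 ^ h.+1))%N -> n%:R <= N < n.+1%:R ->
  [/\ 1 <= ln (6 * N), h%:R / 4 <= ln (ln (6 * N)) & ln (ln (6 * N)) <= 2 * h%:R].
Proof.
move=> h8 nl nu /andP[nN Nn].
have n1 : (1 : R) <= n%:R by rewrite ler1n; apply: leq_trans nl; rewrite expn_gt0.
have N0 : 0 < 6 * N by lra.
have l2 := ln2_ge; have l2' := ln2_le1.
have hR : (8 : R) <= h%:R by rewrite (ler_nat R 8).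
have p2 (k : nat) : 0 < (2 : R) ^+ k by rewrite exprn_gt0.
have lo : 2 ^+ h * ln 2 <= ln (6 * N).
  rewrite -natrX mulr_natl -lnXn // ler_ln ?posrE ?p2 //.
  have : (2 : R) ^+ (2 ^ h) <= n%:R by rewrite -natrX ler_nat.
  lra.
have up : ln (6 * N) <= 2 ^+ (h + 2).
  have : 6 * N <= 2 ^+ (3 + 2 ^ h.+1).
    have : (n.+1%:R : R) <= 2 ^+ (2 ^ h.+1) by rewrite -natrX ler_nat.
    rewrite exprD -[X in _ <= X * _]natrX; have := p2 (2 ^ h.+1)%N.
    set y := 2 ^+ _ => y0 ny; have -> : (2 ^ 3)%N%:R = 8 :> R by [].
    lra.
  rewrite -ler_ln ?posrE ?p2 // => h1; apply: le_trans h1 _.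
  rewrite lnXn // -[ln 2 *+ _]mulr_natr.
  apply: (@le_trans _ _ (1 * (3 + 2 ^ h.+1)%N%:R)); first by rewrite ler_wpM2r.
  rewrite mul1r -natrX ler_nat addn2.
  have : (3 < 2 ^ h.+1)%N by apply: leq_trans (ltn_expl h.+1 (isT : (1 < 2)%N)); lia.
  rewrite [(2 ^ h.+2)%N]expnS; lia.
have big1' : 1 <= ln (6 * N).
  have : (2 : R) <= 2 ^+ h by rewrite -[X in X <= _]expr1 ler_eXn2l ?ltr1n //; lia.
  nra.
have ln0 : 0 < ln (6 * N) by lra.
split => //.
  have : 2 ^+ h.-1 <= ln (6 * N).
    apply: le_trans lo; rewrite -[in X in _ <= X](@prednK h) ?(leq_trans _ h8) // exprS; have := p2 h.-1; nra.
  rewrite -ler_ln ?posrE ?p2 // => h1; apply: le_trans h1.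
  rewrite lnXn // -[ln 2 *+ _]mulr_natr.
  have -> : h.-1%:R = h%:R - 1 :> R.
    by rewrite -[in RHS](@prednK h) ?(leq_trans _ h8) // -natr1 addrK.
  nra.
have : ln (ln (6 * N)) <= ln (2 ^+ (h + 2)) by rewrite ler_ln ?posrE.
rewrite lnXn // -[ln 2 *+ _]mulr_natr natrD; nra.
Qed.

End Logs.

(** With 1/E in place of eps, the 4E-th power makes both exponents integers: (1/4 + 1/(2E)) 4E = E +
    2. *)
Lemma pow_le_of_powR (R : realType) (q n E : nat) (N eps : R) :
  (0 < q)%N -> (0 < E)%N -> 1 <= N -> N <= n.+1%:R -> E%:R^-1 <= eps ->
  q%:R `^ (1 / 4 + eps / 2) <= N `^ (1 / 2) -> (q ^ (E + 2) <= n.+1 ^ (2 * E))%N.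
Proof.
move=> q0 E0 N1 Nn Ee h.
have q1 : (1 : R) <= q%:R by rewrite ler1n.
have ER : (0 : R) < E%:R by rewrite ltr0n.
have h2 : q%:R `^ (1 / 4 + E%:R^-1 / 2) <= N `^ (1 / 2).
  apply: le_trans h; apply: ler_powR => //; lra.
have : (q%:R `^ (1 / 4 + E%:R^-1 / 2)) ^+ (4 * E) <= (N `^ (1 / 2)) ^+ (4 * E).
  by rewrite lerXn2r ?nnegrE ?powR_ge0.
rewrite -!powR_mulrn ?powR_ge0 // -!powRrM.
have -> : (1 / 4 + E%:R^-1 / 2) * (4 * E)%N%:R = (E + 2)%N%:R :> R.
  by rewrite natrM natrD; field; rewrite gt_eqF.
have -> : (1 / 2) * (4 * E)%N%:R = (2 * E)%N%:R :> R by rewrite !natrM; field.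
rewrite !powR_mulrn; [|lra|lra] => h3.
rewrite -(ler_nat R) !natrX; apply: le_trans h3 _.
by rewrite lerXn2r ?nnegrE //; lra.
Qed.

(** In fourth powers: J^4 <= h^2 <= 16 q and (log q)^4 <= 256 q give (16 q)^3 (256 q) = (32 q)^4. *)
Lemma modulus_large_enough (h J q : nat) : (16 <= h)%N -> (J ^ 2 <= h)%N ->
  (h ^ 2 <= 16 * q)%N -> (4 <= q)%N /\ (J ^ 3 * up_log 2 q <= 32 * q)%N.
Proof.
move=> h16 Jh hq.
have q4 : (4 <= q)%N.
  have : (16 ^ 2 <= h ^ 2)%N by rewrite leq_exp2r.
  lia.
split => //; rewrite -(@leq_exp2r _ _ 4) // expnMn.
have q2 : (2 <= q)%N by lia.
have l4 := up_log4_le q2.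
have J4 : (J ^ 4 <= 16 * q)%N.
  apply: leq_trans hq; have -> : (J ^ 4 = (J ^ 2) ^ 2)%N by rewrite -expnM.
  by rewrite leq_exp2r.
have -> : ((J ^ 3) ^ 4 = (J ^ 4) ^ 3)%N by rewrite -!expnM.
apply: (@leq_trans ((16 * q) ^ 3 * (256 * q))%N).
  by apply: leq_mul => //; rewrite leq_exp2r.
have e : (32 ^ 4 = 16 ^ 3 * 256)%N.
  rewrite -[32%N]/(2 ^ 5)%N -[16%N]/(2 ^ 4)%N -[256%N]/(2 ^ 8)%N -!expnM -expnD.
  by congr (_ ^ _)%N.
by rewrite [((16 * q) ^ 3)%N]expnMn [((32 * q) ^ 4)%N]expnMn e [(q ^ 4)%N]expnSr mulnACA.
Qed.

Theorem mainTheorem1 (R : realType) :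
  exists eps0 : R, 0 < eps0 /\
  forall eps : R, 0 < eps -> eps <= eps0 ->
  exists C N0 : R, 0 < C /\
  forall (N : R) (f : nat -> R[i]) (q : nat) (a : int),
    N0 <= N ->
    multiplicative_arith f ->
    (forall n : nat, (0 < n)%N -> `|f n| <= 1) ->
    (0 < q)%N ->
    q%:R <= N ^+ 2 ->
    coprimez a q%:Z ->
    `|\sum_(1 <= n < (Num.truncn N).+1 | coprime n q)
        f n * expi2pi (a%:~R * (invmodn q n)%:R / q%:R)|
    <= (C * (Num.sqrt ((ndivisors q)%:R / q%:R) * N * ln (ln (6 * N))
             + q%:R `^ (1 / 4 + eps / 2) * N `^ (1 / 2)
               * (ln (6 * N)) `^ (1 / 2)
             + N / Num.sqrt (ln (ln (6 * N)))))%:C.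
Proof.
exists 1; split; first by [].
move=> eps eps_gt0 _.
pose E := (Num.truncn eps^-1).+2.
have Eeps : E%:R^-1 <= eps.
  rewrite -[leRHS]invrK lef_pV2 ?posrE ?invr_gt0 ?ltr0n //.
  have := real_truncnS_gt (num_real eps^-1).
  by rewrite /E -[_.+2]addn1 natrD; lra.
have [h0 core] := @inverse_twisted_sum_le R E isT.
(* N >= 2^(2^H0) makes h at least [h0], and at least 16, whence J >= 4 below. In the constant, 200 *
   200 comes from the core estimate and 3 from sqrt(loglog) <= 3 J. *)
pose H0 := maxn h0 16.
exists (200 * 200 * 3), (2 ^+ (2 ^ H0)); split; first by lra.
move=> N f q a hN [f1 fM] fle q0 _ co.
pose n := Num.truncn N; pose h := trunc_log 2 (trunc_log 2 n).
have N1 : 1 <= N.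
  by apply: le_trans hN; rewrite exprn_ege1 // ler1n.
have nN : n%:R <= N < n.+1%:R by apply: truncn_itv; lra.
have nl0 : (2 ^ 2 ^ H0 <= n)%N.
  by rewrite -ltnS -(ltr_nat R) natrX; apply: le_lt_trans hN _; case/andP: nN.
have n0 : (0 < n)%N by apply: leq_trans nl0; rewrite expn_gt0.
have tl0 : (2 ^ H0 <= trunc_log 2 n)%N by apply: trunc_log_max.
have Hh : (H0 <= h)%N by apply: trunc_log_max.
have t0 : (0 < trunc_log 2 n)%N by apply: leq_trans tl0; rewrite expn_gt0.
have [/andP[hl hu] /andP[tl tu]] : (2 ^ h <= trunc_log 2 n < 2 ^ h.+1)%N /\
    (2 ^ trunc_log 2 n <= n < 2 ^ (trunc_log 2 n).+1)%N.
  by split; apply: trunc_log_bounds.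
have nl : (2 ^ 2 ^ h <= n)%N by apply: leq_trans tl; rewrite leq_exp2l.
have nu : (n < 2 ^ 2 ^ h.+1)%N by apply: leq_trans tu _; rewrite leq_exp2l.
have h16 : (16 <= h)%N by apply: leq_trans Hh; rewrite leq_maxr.
have hh0 : (h0 <= h)%N by apply: leq_trans Hh; rewrite leq_maxl.
have h8 : (8 <= h)%N by lia.
have [ln1 lnlo lnup] := lnln_bounds h8 nl nu nN.
have hR : (16 : R) <= h%:R by rewrite (ler_nat R 16).
have q1 : (1 : R) <= q%:R by rewrite ler1n.
set LL := ln (ln (6 * N)) in lnlo lnup *.
have LL0 : 0 < LL by lra.
have T1 : 0 <= Num.sqrt ((ndivisors q)%:R / q%:R) * N * LL.
  by rewrite !mulr_ge0 ?sqrtr_ge0 // ?ltW //; lra.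
have T2 : 0 <= q%:R `^ (1 / 4 + eps / 2) * N `^ (1 / 2) * ln (6 * N) `^ (1 / 2).
  by rewrite !mulr_ge0 ?powR_ge0.
have T3 : 0 <= N / Num.sqrt LL by rewrite divr_ge0 ?sqrtr_ge0 //; lra.
have fle' m : (0 < m)%N -> cabs (f m) <= 1.
  by move=> m0; rewrite -lecR -cabsE; apply: fle.
pose zeta : R[i] := expi2pi (a%:~R / q%:R).
have prim : q.-primitive_root zeta by apply: expi2pi_prim.
have -> : \sum_(1 <= m < n.+1 | coprime m q) f m * expi2pi (a%:~R * (invmodn q m)%:R / q%:R)
   = \sum_(1 <= m < n.+1 | coprime m q) f m * zeta ^+ invmodn q m.
  by apply: eq_bigr => m _; rewrite /zeta expi2piX; congr (_ * expi2pi _); ring.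
rewrite cabsE lecR; set S := cabs _.
have Sn : S <= N.
  apply: (@le_trans _ _ n%:R); last by case/andP: nN.
  apply: le_trans (cabs_sum _ _ _) _; rewrite big_mkcond.
  apply: (@le_trans _ _ (\sum_(1 <= m < n.+1) 1)); last first.
    by rewrite big_const_nat iter_addr_0 subSS subn0.
  rewrite [leLHS]big_nat [leRHS]big_nat; apply: ler_sum => m /andP[m0 _].
  by case: ifP => // _; rewrite cabsM (cabs_zeta prim) mulr1 fle'.
(* If this fails, then tau(q) >= 1 gives (loglog 6N)^2 <= q; otherwise the first term alone is at
   least N. *)
have [c1|c1] := leP 1 (Num.sqrt ((ndivisors q)%:R / q%:R) * LL).
  have : N <= Num.sqrt ((ndivisors q)%:R / q%:R) * N * LL.
    by rewrite mulrAC ler_peMl //; lra.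
  lra.
(* If q^(1/4 + eps/2) >= N^(1/2), the second term is at least N. *)
have [c2|c2] := leP (N `^ (1 / 2)) (q%:R `^ (1 / 4 + eps / 2)).
  have NN : N `^ (1 / 2) * N `^ (1 / 2) = N.
    rewrite -powRD; last by apply/implyP => _; rewrite gt_eqF //; lra.
    by rewrite (_ : 1 / 2 + 1 / 2 = 1) ?powRr1 //; lra.
  have l1 : 1 <= ln (6 * N) `^ (1 / 2).
    by rewrite -[leLHS](powRr0 (ln (6 * N))) ler_powR //; lra.
  have : N <= q%:R `^ (1 / 4 + eps / 2) * N `^ (1 / 2) * ln (6 * N) `^ (1 / 2).
    apply: (@le_trans _ _ (q%:R `^ (1 / 4 + eps / 2) * N `^ (1 / 2))).
      by rewrite -[leLHS]NN ler_wpM2r ?powR_ge0.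
    by rewrite ler_peMr // mulr_ge0 ?powR_ge0.
  lra.
have [J /andP[Jh hJ]] := nat_sqrt_ex h.
have J0 : (0 < J)%N.
  by move: (h) h16 hJ => k; clear; case: J => [|J] //; lia.
have hq : (h ^ 2 <= 16 * q)%N.
  have LLq : LL ^+ 2 <= q%:R.
    have d1 : (1 : R) <= (ndivisors q)%:R.
      rewrite ler1n /ndivisors; have : (1 \in divisors q)%N by rewrite -dvdn_divisors ?dvd1n.
      by case: divisors.
    have : (Num.sqrt ((ndivisors q)%:R / q%:R) * LL) ^+ 2 <= 1.
      by rewrite exprn_ile1 ?mulr_ge0 ?sqrtr_ge0 ?(ltW LL0) ?(ltW c1).
    rewrite exprMn sqr_sqrtr ?divr_ge0 // mulrAC ler_pdivrMr ?mul1r; last by lra.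
    have := sqr_ge0 LL; nra.
  rewrite -(ler_nat R) natrX natrM; have : 0 <= LL by lra.
  nra.
have [q4 Jq] := modulus_large_enough h16 Jh hq.
have qE : (q ^ (E + 2) <= n.+1 ^ (2 * E))%N.
  by apply: (pow_le_of_powR q0 _ N1 _ Eeps (ltW c2)) => //; case/andP: nN => _ /ltW.
have := core h n J q zeta (invmodn q) f hh0 nl nu J0 Jh q4 Jq qE prim (@invmodnP q) fM fle'.
rewrite -/S => bd.
have JR : 0 < J%:R :> R by rewrite ltr0n.
(* loglog 6N <= 2h < 2 (J + 1)^2 <= 9 J^2, the last step by J >= 4. *)
have sL : Num.sqrt LL <= 3 * J%:R.
  have -> : 3 * J%:R = Num.sqrt ((3 * J%:R) ^+ 2) :> R by rewrite sqrtr_sqr ger0_norm ?mulr_ge0.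
  rewrite ler_sqrt ?sqr_ge0 //.
  have h1 : (h%:R : R) + 1 <= (J%:R + 1) ^+ 2 by rewrite !natr1 -natrX ler_nat.
  have J1 : (4 : R) <= J%:R.
    rewrite (ler_nat R 4) -ltnS -(@ltn_exp2r _ _ 2) //.
    exact: leq_ltn_trans h16 hJ.
  nra.
have sL0 : 0 < Num.sqrt LL by rewrite sqrtr_gt0.
have : n%:R / J%:R <= 3 * (N / Num.sqrt LL).
  rewrite mulrA ler_pdivlMr // mulrAC ler_pdivrMr //.
  have : n%:R * Num.sqrt LL <= N * (3 * J%:R).
    by rewrite ler_pM ?sqrtr_ge0 //; case/andP: nN.
  lra.
lra.
Qed.
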